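(* There exists an absolute constant $A>0$ such that for every $\beta>0$ there exists $C>0$ such that for $p=p(n)\ge\frac Cn$, with high probability $G(n,p)\to_2\mathcal C$, where $\mathcal C=\{C_t\mid A\log n\le t\le(\frac12-\beta)n,\ t\text{ is odd}\}$. In particular, with high probability $G(n,p)\to_2C_{\lfloor(\frac12-\beta)n\rfloor_{odd}}$.
   Context: $G(n,p)$ is the binomial random graph on $\{1,\dots,n\}$ with each pair an edge independently with probability $p$. ''With high probability'' means with probability tending to $1$ as $n\to\infty$. $C_t$ is the cycle of length $t$ (with $t$ edges); $\log$ is the natural logarithm. $\lfloor\ell\rfloor_{odd}$ is the largest odd integer $m\le\ell$. For graphs $G,H$, $G\to_rH$ means that every $r$-coloring of the edges of $G$ contains a monochromatic copy of $H$. For a family $\mathcal H$ of graphs, $G\to_r\mathcal H$ means that for every $r$-coloring of the edges of $G$ there exists a color $i$ such that there is a monochromatic copy of every $H\in\mathcal H$ in color $i$. The number $\beta$ in the ''in particular'' part is understood to be small enough that the cycle length is meaningful ($\beta<\frac12$). *)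

(* Defs.v *)
From HB Require Import structures.
From mathcomp Require Import all_boot all_order all_algebra.
From mathcomp Require Import all_classical all_reals all_analysis.

Set Implicit Arguments.
Unset Strict Implicit.
Unset Printing Implicit Defensive.
Import Order.TTheory GRing.Theory Num.Theory.
Import numFieldNormedType.Exports.
Local Open Scope classical_set_scope.
Local Open Scope ring_scope.

Record sgraph := SGraph {
  vertex : finType;
  adj : rel vertex;
  adj_sym : symmetric adj;
  adj_irr : irreflexive adj }.

Lemma edge_adj_sym (V : finType) (E : {set {set V}}) :
  symmetric (fun x y : V => (x != y) && ([set x; y]%SET \in E)).
Proof. by move=> x y; rewrite eq_sym finset.setUC. Qed.

Lemma edge_adj_irr (V : finType) (E : {set {set V}}) :
  irreflexive (fun x y : V => (x != y) && ([set x; y]%SET \in E)).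
Proof. by move=> x; rewrite eqxx. Qed.

Definition graph_of_edges (V : finType) (E : {set {set V}}) : sgraph :=
  SGraph (@edge_adj_sym V E) (@edge_adj_irr V E).

Lemma cycle_adj_sym (t : nat) :
  symmetric (fun x y : 'I_t => (x != y) && ((y == ordS x) || (x == ordS y))).
Proof. by move=> x y; rewrite eq_sym orbC. Qed.

Lemma cycle_adj_irr (t : nat) :
  irreflexive (fun x y : 'I_t => (x != y) && ((y == ordS x) || (x == ordS y))).
Proof. by move=> x; rewrite eqxx. Qed.

(* [ordS] is the cyclic successor on 'I_t.  This is the cycle with t edges as
   soon as 3 <= t; smaller t give degenerate (path or empty) graphs. *)
Definition cycle_graph (t : nat) : sgraph :=
  SGraph (@cycle_adj_sym t) (@cycle_adj_irr t).

(* Copies are subgraphs, not necessarily induced. *)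
Definition has_copy (G H : sgraph) : Prop :=
  exists f : vertex H -> vertex G,
    injective f /\ forall x y, adj x y -> adj (f x) (f y).

(* A colouring assigns a colour to every set of vertices, but only the colours
   of the edges {x, y} of the graph are ever used; for r > 0 this is the same
   as ranging over all maps from the edge set to 'I_r. *)
Definition coloring (G : sgraph) (r : nat) := {set vertex G} -> 'I_r.

Lemma color_adj_sym (G : sgraph) (r : nat) (c : coloring G r) (i : 'I_r) :
  symmetric (fun x y : vertex G => adj x y && (c [set x; y]%SET == i)).
Proof. by move=> x y; rewrite adj_sym finset.setUC. Qed.

Lemma color_adj_irr (G : sgraph) (r : nat) (c : coloring G r) (i : 'I_r) :
  irreflexive (fun x y : vertex G => adj x y && (c [set x; y]%SET == i)).
Proof. by move=> x; rewrite adj_irr. Qed.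

Definition color_class (G : sgraph) (r : nat) (c : coloring G r) (i : 'I_r) :
    sgraph :=
  SGraph (@color_adj_sym G r c i) (@color_adj_irr G r c i).

Definition arrows (G : sgraph) (r : nat) (H : sgraph) : Prop :=
  forall c : coloring G r, exists i : 'I_r, has_copy (color_class c i) H.

(* One single colour must work for all members of the family. *)
Definition arrows_family (G : sgraph) (r : nat) (F : sgraph -> Prop) :
    Prop :=
  forall c : coloring G r, exists i : 'I_r,
    forall H : sgraph, F H -> has_copy (color_class c i) H.

Definition vertex_pairs (n : nat) : {set {set 'I_n}} :=
  [set e : {set 'I_n} | #|e| == 2%N]%SET.

(* Probability that G(n,p) satisfies Q, for 0 <= p <= 1. *)
Definition gnp_prob (R : realType) (n : nat) (p : R) (Q : sgraph -> Prop) : R :=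
  \sum_(E : {set {set 'I_n}} |
          (E \subset vertex_pairs n) && `[< Q (graph_of_edges E) >])
    \prod_(e in vertex_pairs n) (if e \in E then p else 1 - p).

Definition whp (R : realType) (p : nat -> R) (Q : nat -> sgraph -> Prop) :
    Prop :=
  (fun n : nat => gnp_prob n (p n) (Q n)) @ \oo --> (1 : R).

(* The value is 0 when l < 1, where there is no odd natural number below l. *)
Definition floor_odd (R : realType) (l : R) : nat :=
  \max_(m < (Num.truncn l).+1 | odd m) (m : nat).

Definition odd_cycles (R : realType) (A beta : R) (n : nat) (H : sgraph) :
    Prop :=
  exists t : nat,
    [/\ odd t, A * ln n%:R <= t%:R <= (1 / 2 - beta) * n%:R &
        H = cycle_graph t].

(* Main.v *)
(** Call a pair of vertex sets [g]-joined in a colour if any two subsets of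
    size at least [g] span an edge of that colour.  With high probability any
    two disjoint sets of size [e = n %/ Z] span an edge of [G(n,p)], so a pair
    with no [e]-edge of one colour is [e]-joined in the other; nothing else
    about the random graph is needed.

    In a joined pair, depth-first search gives a nearly spanning alternating
    path and, after deleting few vertices, breadth-first search gives disjoint
    binary trees of depth about [log n] from almost every vertex.  Fix a core of
    three pairwise joined sets [U1], [U2], [U3].  A long path is started and
    ended in [(U1, U2)]; it traverses disjoint joined pairs (tiles), entered and
    left through short connecting paths to [U1] that were reserved beforehand.
    Two trees in [(U1, U2)] whose leaves have a common neighbour in [U3] join
    almost any two core vertices by a path of one fixed length, whatever sides
    they lie on; moving the two ends along the long path then yields cycles of
    every length, odd or even.

    Let [H] be the colour of a core.  Deleting a set [F0] that minimises
    [#|component F| + rho * #|F|] leaves a component [R] of [U1] from which few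
    further deletions detach few vertices; between [R] and the rest [B] all
    edges have the other colour [J].  Exhaust [R] by [H]-joined tiles, [R = A + L]
    with [L] joined inside itself in [J], and [B] by [J]-joined tiles,
    [B = B' + M] with [M] joined inside itself in [H].  If one of [A], [L], [M]
    has about [n/2] vertices, it carries all the cycles.  Otherwise [L] or [B']
    is large, so [J] contains a core connected to everything through [(R, B)],
    and the [J]-tiles of [L], [B'] and [(A, M)] cover
    [b + l + 2 min(a, m) >= n/2] vertices. *)

From Stdlib Require Import Classical_Prop.
From mathcomp Require Import all_boot zify.

Set Implicit Arguments.
Unset Strict Implicit.
Unset Printing Implicit Defensive.

(** * Paths and depth-first search *)

Definition trim (V : finType) k (A : {set V}) := [set x in take k (enum A)].

Lemma trim_sub (V : finType) k (A : {set V}) : trim k A \subset A.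
Proof. by apply/subsetP => x; rewrite inE => /mem_take; rewrite mem_enum. Qed.

Lemma trim_card (V : finType) k (A : {set V}) : k <= #|A| -> #|trim k A| = k.
Proof.
move=> hk; rewrite cardsE (card_uniqP _) ?take_uniq ?enum_uniq // size_takel //.
by rewrite -cardE.
Qed.

Lemma subset_of_card (V : finType) (A : {set V}) k :
  k <= #|A| -> exists2 B : {set V}, B \subset A & #|B| = k.
Proof. by move=> hk; exists (trim k A); [exact: trim_sub|exact: trim_card]. Qed.

Lemma card_setU_le (V : finType) (A B : {set V}) : #|A :|: B| <= #|A| + #|B|.
Proof. by rewrite cardsU leq_subr. Qed.

Lemma card_disjointU (V : finType) (A B : {set V}) :
  [disjoint A & B] -> #|A :|: B| = #|A| + #|B|.
Proof. by move=> d; rewrite cardsU (disjoint_setI0 d) cards0 subn0. Qed.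

Lemma disjointUl (V : finType) (A B C : {set V}) :
  [disjoint A :|: B & C] = [disjoint A & C] && [disjoint B & C].
Proof. by rewrite -!setI_eq0 setIUl setU_eq0. Qed.

Lemma disjointUr (V : finType) (A B C : {set V}) :
  [disjoint C & A :|: B] = [disjoint C & A] && [disjoint C & B].
Proof. by rewrite ![[disjoint C & _]]disjoint_sym disjointUl. Qed.

Lemma disjoint_sub (V : finType) (A B A' B' : {set V}) :
  [disjoint A & B] -> A' \subset A -> B' \subset B -> [disjoint A' & B'].
Proof. by move=> d /disjointWl h /disjointWr h'; apply: h; apply: h'. Qed.

Lemma disjointDl (V : finType) (A B : {set V}) : [disjoint A :\: B & B].
Proof. by rewrite -setI_eq0 setIDAC setDIl setDv setI0. Qed.

Lemma card_setD_ge (V : finType) (A B : {set V}) : #|A| - #|B| <= #|A :\: B|.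
Proof. by rewrite cardsD leq_sub2l // subset_leq_card // subsetIr. Qed.

Section Paths.
Variables (V : finType) (H : rel V).

(** The exact length [k] is kept, while [D] is only a set containing the path: concatenation then
    needs no more than disjointness of the two sets. *)
Definition conn (D : {set V}) (x y : V) (k : nat) :=
  exists p, [/\ path H x p, last x p = y, uniq (x :: p),
                {subset x :: p <= D} & size p = k].

Definition has_cycle (t : nat) :=
  exists s, [/\ uniq s, cycle H s & size s = t].

Lemma conn_refl (D : {set V}) x : x \in D -> conn D x x 0.
Proof.
move=> xD; exists [::]; split => //.
by move=> z; rewrite inE => /eqP ->.
Qed.

Lemma conn_mono (D D' : {set V}) x y k :
  D \subset D' -> conn D x y k -> conn D' x y k.
Proof.
move=> /subsetP sD [p [h1 h2 h3 h4 h5]]; exists p; split => //.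
by move=> z /h4 /sD.
Qed.

Lemma conn_inl (D : {set V}) x y k : conn D x y k -> x \in D.
Proof. by case=> p [_ _ _ h _]; apply: h; rewrite inE eqxx. Qed.

Lemma conn_inr (D : {set V}) x y k : conn D x y k -> y \in D.
Proof. by case=> p [_ <- _ h _]; apply: h; apply: mem_last. Qed.

Lemma conn_cat (D1 D2 : {set V}) x y y' z k1 k2 :
  conn D1 x y k1 -> H y y' -> conn D2 y' z k2 -> [disjoint D1 & D2] ->
  conn (D1 :|: D2) x z (k1 + k2).+1.
Proof.
move=> [p [p1 p2 p3 p4 p5]] hy [q [q1 q2 q3 q4 q5]] dD.
exists (p ++ y' :: q); split.
- by rewrite cat_path p1 /= p2 hy q1.
- by rewrite last_cat /=.
- rewrite -cat_cons cat_uniq p3 q3 andbT andTb.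
  apply/hasPn => u uq; apply/negP => up.
  by have := disjointFr dD (p4 _ up); rewrite (q4 _ uq).
- by move=> u; rewrite -cat_cons mem_cat in_setU => /orP[/p4->//|/q4->]; rewrite orbT.
- by rewrite size_cat /= p5 q5 addnS.
Qed.

Lemma conn_cons (D : {set V}) x y z k :
  H x y -> x \notin D -> conn D y z k -> conn (x |: D) x z k.+1.
Proof.
move=> hxy xD c.
have := conn_cat (conn_refl (set11 x)) hxy c.
by rewrite add0n disjoints1; apply.
Qed.

Hypothesis Hsym : symmetric H.

Lemma conn_sym (D : {set V}) x y k : conn D x y k -> conn D y x k.
Proof.
case=> p [h1 h2 h3 h4 h5].
have E : rev (x :: p) = y :: rev (belast x p).
  by rewrite lastI rev_rcons h2.
exists (rev (belast x p)); split.
- have := rev_path H x p; rewrite h2 => ->.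
  by rewrite (eq_path (e' := H)) // => u v; rewrite /= Hsym.
- have : last y (y :: rev (belast x p)) = x by rewrite -E rev_cons last_rcons.
  by [].
- by rewrite -E rev_uniq.
- by move=> z; rewrite -E mem_rev; apply: h4.
- by rewrite size_rev size_belast.
Qed.

Lemma conn_seq (s : seq V) x0 i j :
  sorted H s -> uniq s -> i <= j < size s ->
  conn [set x in s] (nth x0 s i) (nth x0 s j) (j - i).
Proof.
move=> hs us /andP[ij js].
have hi : i < size s by apply: leq_ltn_trans js.
have E : drop i s = nth x0 s i :: drop i.+1 s by rewrite (drop_nth x0).
have hp : path H (nth x0 s i) (drop i.+1 s).
  by have := drop_sorted i hs; rewrite E.
have ET : take (j - i).+1 (drop i s) =
    nth x0 s i :: take (j - i) (drop i.+1 s) by rewrite E.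
exists (take (j - i) (drop i.+1 s)); split.
- exact: take_path.
- have -> : last (nth x0 s i) (take (j - i) (drop i.+1 s)) =
      last x0 (take (j - i).+1 (drop i s)) by rewrite ET.
  have sz : size (take (j - i).+1 (drop i s)) = (j - i).+1.
    by rewrite size_takel // size_drop; lia.
  by rewrite (last_nth x0) sz /= nth_take ?nth_drop ?subnKC // ltnSn.
- by rewrite -ET take_uniq // drop_uniq.
- by move=> z; rewrite -ET => /mem_take /mem_drop; rewrite inE.
- by rewrite size_takel // size_drop; lia.
Qed.

Lemma conn_cycle (D : {set V}) x y k :
  conn D x y k -> H y x -> has_cycle k.+1.
Proof.
case=> p [h1 h2 h3 _ h5] hyx; exists (x :: p); split => //=.
  by rewrite rcons_path h1 h2.
by rewrite h5.
Qed.

(* Depth-first search: one step moves a vertex either from the unexplored set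
   [S] to the stack [p] or from [p] to the finished set [T], so [#|S| - #|T|]
   decreases by exactly one. *)
Lemma dfs_partition (D : {set V}) :
  exists (S T : {set V}) (p : seq V),
    [/\ sorted H p, uniq p, #|S| = #|T|,
        (forall x, (x \in D) = [|| x \in S, x \in T | x \in p]) /\
        (forall x, (x \in S) + (x \in T) + (x \in p) <= 1) &
        (forall x y, x \in S -> y \in T -> ~~ H x y)].
Proof.
suff main d : d <= #|D| -> exists (S T : {set V}) (p : seq V),
    [/\ sorted H p, uniq p, #|S| = #|T| + d,
        (forall x, (x \in D) = [|| x \in S, x \in T | x \in p]) /\
        (forall x, (x \in S) + (x \in T) + (x \in p) <= 1) &
        (forall x y, x \in S -> y \in T -> ~~ H x y)].
  have [S [T [p [h1 h2 h3 h4 h5]]]] := main 0 (leq0n _).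
  by exists S, T, p; split => //; rewrite h3 addn0.
move=> hd; have [k ek] : exists k, k = #|D| - d by exists (#|D| - d).
elim: k d hd ek => [|k IH] d hd ek.
  (* The search starts here, with everything unexplored; each step of the induction lowers the
     difference [d] by one. *)
  have -> : d = #|D| by lia.
  exists D, set0, [::]; split => //; first by rewrite cards0.
    split=> x; first by rewrite inE in_nil !orbF.
    by rewrite inE in_nil; case: (x \in D).
  by move=> x y _; rewrite inE.
have [||S [T [p [h1 h2 h3 [h4 h5] h6]]]] := IH d.+1; try lia.
have [x0 x0S] : exists x, x \in S.
  by apply/set0Pn; rewrite -card_gt0 h3; lia.
have push x : x \in S -> sorted H (x :: p) ->
  exists (S T : {set V}) (p : seq V),
    [/\ sorted H p, uniq p, #|S| = #|T| + d,
        (forall x, (x \in D) = [|| x \in S, x \in T | x \in p]) /\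
        (forall x, (x \in S) + (x \in T) + (x \in p) <= 1) &
        (forall x y, x \in S -> y \in T -> ~~ H x y)].
  move=> xS hp; exists (S :\ x), T, (x :: p); split => //.
  - by rewrite /= h2 andbT; have := h5 x; rewrite xS; case: (x \in p); lia.
  - by have := cardsD1 x S; rewrite xS; lia.
  - split=> y; rewrite !inE; have := h5 y; rewrite ?h4.
      by case: (eqVneq y x) => [->|_]; rewrite ?xS //= orbT.
    by case: (eqVneq y x) => [->|_] //; rewrite xS; case: (x \in T).
  - by move=> u v; rewrite !inE => /andP[_]; apply: h6.
case: p h1 h2 h4 h5 push => [|a p] h1 h2 h4 h5 push; first exact: (push x0).
have [/existsP[y /andP[yS hy]]|/existsPn nE] := boolP [exists y, (y \in S) && H y a].
  by apply: (push y) => //=; rewrite hy; move: h1.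
exists S, (a |: T), p; split => //.
- by case: {+}p h1 => //= b q /andP[].
- by case/andP: h2.
- have aT : a \notin T by have := h5 a; rewrite inE eqxx; case: (a \in T) => //; lia.
  by rewrite cardsU1 aT h3 /=; lia.
- split=> y; rewrite ?h4 !inE; first by case: (y \in S); case: (y == a); case: (y \in T).
  have := h5 y; rewrite inE; case: (eqVneq y a) => [->|_] //=.
  case/andP: h2 => /negPf -> _.
  by case: (a \in S); case: (a \in T).
- move=> u v uS; rewrite !inE => /orP[/eqP->|]; last exact: h6.
  by have := nE u; rewrite uS.
Qed.

End Paths.

(** * Joined pairs of sets *)

Section Joined.
Variables (V : finType) (H : rel V).
Hypothesis Hsym : symmetric H.

Definition joined (g : nat) (X Y : {set V}) :=
  forall A B : {set V}, A \subset X -> B \subset Y -> g <= #|A| -> g <= #|B| ->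
  exists a b, [/\ a \in A, b \in B & H a b].

Definition nbhd (A : {set V}) := [set y | [exists a in A, H a y]].

Lemma nbhdP (A : {set V}) y :
  reflect (exists2 a, a \in A & H a y) (y \in nbhd A).
Proof. by rewrite inE; apply: exists_inP. Qed.

Lemma nbhdU (A B : {set V}) : nbhd (A :|: B) = nbhd A :|: nbhd B.
Proof.
apply/setP => y; rewrite in_setU; apply/nbhdP/orP.
  by case=> a; rewrite in_setU => /orP[] ? ?; [left|right]; apply/nbhdP; exists a.
by case=> /nbhdP[a aA h]; exists a; rewrite // in_setU aA ?orbT.
Qed.

Lemma nbhdS (A B : {set V}) : A \subset B -> nbhd A \subset nbhd B.
Proof.
move=> /subsetP sAB; apply/subsetP => y /nbhdP[a /sAB aB h].
by apply/nbhdP; exists a.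
Qed.

Lemma joined_sym g (X Y : {set V}) : joined g X Y -> joined g Y X.
Proof.
move=> j A B hA hB gA gB; have [b [a [? ? h]]] := j B A hB hA gB gA.
by exists a, b; rewrite Hsym.
Qed.

Lemma joined_sub g (X Y X' Y' : {set V}) :
  joined g X Y -> X' \subset X -> Y' \subset Y -> joined g X' Y'.
Proof.
move=> j hX hY A B hA hB; apply: j; [exact: subset_trans hX|exact: subset_trans hY].
Qed.

Lemma joined_leq g g' (X Y : {set V}) : g <= g' -> joined g X Y -> joined g' X Y.
Proof. by move=> hg j A B hA hB gA gB; apply: j => //; apply: leq_trans hg _. Qed.

Lemma joined_nbhd g (X Y A B : {set V}) :
  joined g X Y -> A \subset X -> B \subset Y -> g <= #|A| -> #|B :\: nbhd A| < g.
Proof.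
move=> j hA hB gA; rewrite ltnNge; apply/negP => gB.
have [] := j A (B :\: nbhd A) hA _ gA gB; first exact: subset_trans (subsetDl _ _) hB.
move=> a [b [aA]]; rewrite inE => /andP[/nbhdP nb _] hab.
by apply: nb; exists a.
Qed.

(** Searching in this relation instead of [H] forces the path to alternate between the two sides. *)
Definition bip (X Y : {set V}) : rel V :=
  fun x y => H x y && ((x \in X) && (y \in Y) || (x \in Y) && (y \in X)).

Lemma bip_sub X Y : subrel (bip X Y) H.
Proof. by move=> x y /andP[]. Qed.

(** The sides alternate, so the side of the first vertex leads by zero or one. *)
Lemma bip_path_count (X Y : {set V}) x p :
  [disjoint X & Y] -> path (bip X Y) x p -> x \in X :|: Y ->
  if x \in X then count [in Y] (x :: p) <= count [in X] (x :: p) <= (count [in Y] (x :: p)).+1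
  else count [in X] (x :: p) <= count [in Y] (x :: p) <= (count [in X] (x :: p)).+1.
Proof.
move=> d; elim: p x => [|y p IH] x /=.
  move=> _; rewrite in_setU; case: (boolP (x \in X)) => xX; first by rewrite (disjointFr d xX).
  by move=> /= ->.
move=> /andP[/andP[_ xy] hp] hx.
have {}IH := IH y hp.
case/orP: xy => /andP[hx' hy]; move: IH; rewrite /= in_setU hy ?orbT => /(_ isT).
  by rewrite hx' (disjointFr d hx') (disjointFl d hy); lia.
by rewrite hx' (disjointFl d hx') (disjointFr d hy); lia.
Qed.

Lemma bip_count (X Y : {set V}) p :
  [disjoint X & Y] -> sorted (bip X Y) p -> {subset p <= X :|: Y} ->
  [/\ count [in X] p <= (count [in Y] p).+1, count [in Y] p <= (count [in X] p).+1
    & count [in X] p + count [in Y] p = size p].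
Proof.
move=> d hp sp; split.
- case: p hp sp => // x p hp sp; have := bip_path_count d hp (sp x (mem_head _ _)).
  by case: ifP => _; lia.
- case: p hp sp => // x p hp sp; have := bip_path_count d hp (sp x (mem_head _ _)).
  by case: ifP => _; lia.
- rewrite -count_predUI addnC (_ : count (predI _ _) p = 0) ?add0n.
    apply/eqP; rewrite -all_count; apply/allP => x /sp; by rewrite in_setU.
  apply/eqP; rewrite -leqn0 leqNgt -has_count; apply/hasPn => x _ /=.
  by apply/negP => /andP[h1 h2]; move: (disjointFr d h1); rewrite h2.
Qed.

(** This is how short segments of a long path are entered and left: [2 * g] consecutive vertices
    have [g] on the required side, enough for joinedness to apply. *)
Lemma bip_segment (X Y : {set V}) p c :
  [disjoint X & Y] -> sorted (bip X Y) p -> {subset p <= X :|: Y} ->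
  size p = c.*2 -> uniq p ->
  #|[set y in Y | y \in p]| = c /\ #|[set x in X | x \in p]| = c.
Proof.
move=> d hp sp sz up; have [h1 h2 h3] := bip_count d hp sp.
have E (Z : {set V}) : #|[set y in Z | y \in p]| = count [in Z] p.
  rewrite -size_filter -(card_uniqP (filter_uniq _ up)).
  by apply: eq_card => z; rewrite inE mem_filter.
by rewrite !E; lia.
Qed.

(** The unvisited set [S] and the finished set [T] of the search have equal size and no edge across
    the pair between them. As the path takes almost equally many vertices from [X] and [Y], the
    parts [X :&: S] and [Y :&: T] have equal size, and so have [X :&: T] and [Y :&: S]; joinedness
    keeps all four below [g]. *)
Lemma long_bip_path g m (X Y : {set V}) :
  [disjoint X & Y] -> joined g X Y -> #|X| = m -> #|Y| = m ->
  exists p, [/\ sorted (bip X Y) p, uniq p, {subset p <= X :|: Y} &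
                m.*2 <= size p + 4 * g].
Proof.
move=> d j cX cY.
have bs : symmetric (bip X Y).
  by move=> x y; rewrite /bip Hsym orbC andbC [(y \in X) && _]andbC [(y \in Y) && _]andbC andbC.
have [S [T [p [h1 h2 h3 [h4 h5] h6]]]] := dfs_partition (bip X Y) (X :|: Y).
have sp : {subset p <= X :|: Y} by move=> x xp; rewrite h4 xp !orbT.
exists p; split => //.
have [c1 c2 c3] := bip_count d h1 sp.
have part (Z : {set V}) : Z \subset X :|: Y ->
    #|Z| = #|Z :&: S| + #|Z :&: T| + count [in Z] p.
  move=> /subsetP hZ.
  have -> : count [in Z] p = #|[set x in Z | x \in p]|.
    rewrite -size_filter -(card_uniqP (filter_uniq _ h2)).
    by apply: eq_card => z; rewrite inE mem_filter.
  rewrite -!card_disjointU; first last.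
  - rewrite -setI_eq0; apply/eqP/setP => x; rewrite !inE; have := h5 x.
    by case: (x \in S) => //; case: (x \in T); case: (x \in p); rewrite ?andbF.
  - rewrite -setI_eq0; apply/eqP/setP => x; rewrite !inE; have := h5 x.
    by case: (x \in S) => //; case: (x \in T); case: (x \in p); rewrite ?andbF.
  apply: eq_card => x; rewrite !inE; case E: (x \in Z) => //=.
  by have := h4 x; rewrite hZ // => /esym; rewrite orbA.
have pX := part X (subsetUl _ _); have pY := part Y (subsetUr _ _).
have cS : #|S| = #|X :&: S| + #|Y :&: S|.
  rewrite -card_disjointU; last first.
    exact: disjoint_sub d (subsetIl _ _) (subsetIl _ _).
  rewrite -setIUl; apply: eq_card => x; rewrite in_setI h4.
  by case: (x \in S); rewrite ?andbF.
have cT : #|T| = #|X :&: T| + #|Y :&: T|.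
  rewrite -card_disjointU; last first.
    exact: disjoint_sub d (subsetIl _ _) (subsetIl _ _).
  rewrite -setIUl; apply: eq_card => x; rewrite in_setI h4.
  by case: (x \in T); rewrite ?orbT ?andbF.
have hole1 : g <= #|X :&: S| -> g <= #|Y :&: T| -> False.
  move=> gS gT; have [a [b []]] := j _ _ (subsetIl _ _) (subsetIl _ _) gS gT.
  rewrite !inE => /andP[aX aS] /andP[bY bT] hab.
  by have := h6 a b aS bT; rewrite /bip hab aX bY.
have hole2 : g <= #|X :&: T| -> g <= #|Y :&: S| -> False.
  move=> gT gS; have [a [b []]] := j _ _ (subsetIl _ _) (subsetIl _ _) gT gS.
  rewrite !inE => /andP[aX aS] /andP[bY bT] hab.
  by have := h6 b a bT aS; rewrite /bip Hsym hab aX bY orbT.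
by lia.
Qed.

(* A maximal non-expanding set of at most [2 g] vertices is deleted: adding a
   non-expanding subset of the rest gives a larger non-expanding set, which by
   maximality has more than [2 g] vertices, contradicting joinedness. *)
Lemma expanding_core g r (Q1 Q2 : {set V}) :
  [disjoint Q1 & Q2] -> joined g Q1 Q2 -> 21 * g <= r ->
  #|Q1| = r -> #|Q2| = r ->
  exists Q' : {set V}, [/\ Q' \subset Q1 :|: Q2, #|(Q1 :|: Q2) :\: Q'| <= g.*2 &
    forall S : {set V}, S \subset Q' -> #|S| <= g.*2 -> 4 * #|S| <= #|nbhd S :&: Q'|].
Proof.
move=> d j hr c1 c2; set Q := Q1 :|: Q2.
pose bad (B : {set V}) := [&& B \subset Q, #|B| <= g.*2 & #|nbhd B :&: (Q :\: B)| <= 4 * #|B|].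
have bad0 : bad set0.
  rewrite /bad sub0set cards0 /= muln0 leqn0 cards_eq0 -subset0.
  apply/subsetP => x; rewrite inE => /andP[/nbhdP[a]]; by rewrite inE.
have [B /maxsetP[/and3P[BQ Bg BN] Bmax]] := ex_maxset (ex_intro bad _ bad0).
exists (Q :\: B); split; first exact: subsetDl.
  by rewrite setDDr setDv set0U (setIidPr BQ).
move=> S SQ' Sg; rewrite leqNgt; apply/negP => SN.
have dBS : [disjoint B & S].
  rewrite disjoint_sym; apply: disjointWl SQ' _.
  by rewrite -setI_eq0 setIDAC setDIl setDv setI0.
have S0 : S != set0.
  by apply/eqP => S0; move: SN; rewrite S0 cards0 muln0.
have SQ : S \subset Q by apply: subset_trans SQ' (subsetDl _ _).
have hN : #|nbhd (B :|: S) :&: (Q :\: (B :|: S))| <= 4 * #|B :|: S|.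
  rewrite card_disjointU //; apply: (@leq_trans (#|nbhd B :&: (Q :\: B)| + #|nbhd S :&: (Q :\: B)|)); last by lia.
  apply: leq_trans (card_setU_le _ _); apply: subset_leq_card.
  rewrite nbhdU; apply/subsetP => x; rewrite !inE.
  case: (x \in B) => //=; first by rewrite andbF.
  case: (x \in S) => //=; first by rewrite andbF.
  by case/andP=> /orP[] -> ->; rewrite ?orbT.
have BSQ : B :|: S \subset Q by rewrite subUset BQ.
have cBS : #|B :|: S| = #|B| + #|S| by rewrite card_disjointU.
have [le|gt] := leqP #|B :|: S| g.*2.
  have /Bmax E : bad (B :|: S) by rewrite /bad BSQ le.
  have : S \subset B by rewrite -E ?subsetUl // subsetUr.
  move=> SB; case/set0Pn: S0 => x xS; have := disjointFl dBS xS.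
  by rewrite (subsetP SB).
have W4 : #|B :|: S| <= 4 * g by lia.
move: hN BSQ gt W4; move: (B :|: S) => W hN BSQ gt W4.
(* If [W] has [g] vertices on one side, they see all but [g] of the other side, which exceeds the at
   most [16 * g] outer neighbours and [4 * g] vertices of [W] once [r >= 21 * g]. *)
have side (P1 P2 : {set V}) : joined g P1 P2 -> #|P2| = r -> P1 :|: P2 = Q -> g <= #|W :&: P1| -> False.
  move=> jP cP eQ gW.
  have := joined_nbhd jP (subsetIr W P1) (subxx P2) gW.
  have -> : #|P2 :\: nbhd (W :&: P1)| = #|P2| - #|P2 :&: nbhd (W :&: P1)| by rewrite cardsD.
  have : #|P2 :&: nbhd (W :&: P1)| <= #|nbhd W :&: (Q :\: W)| + #|W|.
    apply: leq_trans (card_setU_le _ _); apply: subset_leq_card.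
    apply/subsetP => x; rewrite -eQ !in_setU in_setI => /andP[xP /nbhdP[a]].
    rewrite in_setI => /andP[aW _] ha; case E: (x \in W); first by rewrite orbT.
    rewrite orbF in_setI in_setD E in_setU xP orbT !andbT; apply/nbhdP; by exists a.
  have : g.*2 = g + g by rewrite addnn.
  by rewrite cP; lia.
have cW : #|W| <= #|W :&: Q1| + #|W :&: Q2|.
  apply: leq_trans (card_setU_le _ _); apply: subset_leq_card.
  by rewrite -setIUr subsetI subxx BSQ.
have [g1|g1] := leqP g #|W :&: Q1|; first exact: (side Q1 Q2).
have [g2|g2] := leqP g #|W :&: Q2|; first by apply: (side Q2 Q1) => //; [exact: joined_sym|rewrite setUC].
by lia.
Qed.

(** The last level [T] has [4 * 2 ^ j] neighbours in [Q], and the tree so far occupies fewer than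
    [2 ^ j.+1] vertices, so [2 ^ j.+1] new ones remain for the next level. Expansion is applied to
    levels up to [j.-1] only. *)
Lemma bush (Q : {set V}) g x j :
  (forall S : {set V}, S \subset Q -> #|S| <= g -> 4 * #|S| <= #|nbhd S :&: Q|) ->
  x \in Q -> 2 ^ j.-1 <= g ->
  exists T U : {set V}, [/\ T \subset U, U \subset Q, #|T| = 2 ^ j, #|U| < 2 ^ j.+1 &
    forall y, y \in T -> conn H U x y j].
Proof.
move=> ex xQ; elim: j => [|j IH] hj.
  exists [set x], [set x]; rewrite subxx sub1set xQ cards1; split => //.
  by move=> y; rewrite inE => /eqP ->; apply: conn_refl; rewrite inE.
have [|T [U [TU UQ cT cU hT]]] := IH.
  by apply: leq_trans hj; case: j {IH} => //= j; rewrite leq_exp2l.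
have := ex T (subset_trans TU UQ); rewrite cT => /(_ hj) hN.
have : 2 ^ j.+1 <= #|(nbhd T :&: Q) :\: U|.
  apply: leq_trans (card_setD_ge _ _); move: cU hN; rewrite !expnS; lia.
move=> /subset_of_card[T' T'N cT']; exists T', (T' :|: U); split => //.
- exact: subsetUl.
- rewrite subUset UQ andbT; apply: subset_trans T'N _.
  by apply: subset_trans (subsetDl _ _) (subsetIr _ _).
- apply: leq_ltn_trans (card_setU_le _ _) _; rewrite cT' [X in _ < X]expnS; lia.
- move=> y yT'; have := subsetP T'N y yT'.
  rewrite in_setD in_setI => /and3P[yU /nbhdP[a aT ay] _].
  apply: conn_mono (_ : y |: U \subset _) _; first by rewrite setSU // sub1set.
  rewrite setUC; have := conn_cat (hT a aT) ay (conn_refl H (set11 y)).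
  by rewrite addn0; apply; rewrite disjoint_sym disjoints1.
Qed.

End Joined.

(** * Closing a path through two trees *)

Section Closing.
Variables (V : finType) (H : rel V).
Hypothesis Hsym : symmetric H.

Local Notation joined := (joined H).
Local Notation conn := (conn H).
Local Notation nbhd := (nbhd H).

(** The expanding core of [Q1 :|: Q2] loses at most [2 * g] of its [42 * g] vertices, so at least
    [g] survive on each side and almost all of [U1] and [U2] have a neighbour in [Q]. Of the
    [2 ^ h >= 2 * g] leaves of a tree, [g] lie on one side. *)
Lemma reservoir g h (U1 U2 Q1 Q2 : {set V}) :
  [disjoint U1 & U2] -> joined g U1 U2 -> Q1 \subset U1 -> Q2 \subset U2 ->
  #|Q1| = 21 * g -> #|Q2| = 21 * g -> 2 * g <= 2 ^ h -> 2 ^ h.-1 <= 2 * g ->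
  exists Q : {set V}, [/\ Q \subset Q1 :|: Q2, #|U1 :\: nbhd Q| < g, #|U2 :\: nbhd Q| < g &
    forall x, x \in Q -> exists T : {set V},
      [/\ T \subset U1 \/ T \subset U2, g <= #|T| & forall y, y \in T -> conn Q x y h]].
Proof.
move=> d j h1 h2 c1 c2 hh hh'.
have dQ : [disjoint Q1 & Q2] by apply: disjoint_sub d h1 h2.
have [Q [QQ cQ ex]] := expanding_core Hsym dQ (joined_sub j h1 h2) (leqnn _) c1 c2.
have big (P : {set V}) : P \subset Q1 :|: Q2 -> #|P| = 21 * g -> g <= #|P :&: Q|.
  move=> sP cP; have : #|P :\: Q| <= 2 * g.
    by apply: leq_trans (subset_leq_card (setSD Q sP)) _; rewrite mul2n.
  by rewrite cardsD cP; lia.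
exists Q; split => //.
- apply: leq_ltn_trans (subset_leq_card (setDS U1 (nbhdS H (subsetIr Q2 Q)))) _.
  apply: (joined_nbhd (joined_sym Hsym j)) (subxx U1) _; last by apply: big => //; apply: subsetUr.
  exact: subset_trans (subsetIl _ _) h2.
- apply: leq_ltn_trans (subset_leq_card (setDS U2 (nbhdS H (subsetIr Q1 Q)))) _.
  apply: (joined_nbhd j) (subxx U2) _; last by apply: big => //; apply: subsetUl.
  exact: subset_trans (subsetIl _ _) h1.
have ex2 (S : {set V}) : S \subset Q -> #|S| <= 2 * g -> 4 * #|S| <= #|nbhd S :&: Q|.
  by rewrite mul2n; apply: ex.
move=> x xQ; have [T [U [TU UQ cT _ hT]]] := bush ex2 xQ hh'.
have cTT : #|T| <= #|T :&: Q1| + #|T :&: Q2|.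
  apply: leq_trans (card_setU_le _ _); apply: subset_leq_card.
  by rewrite -setIUr subsetI subxx (subset_trans TU) // (subset_trans UQ).
have conv y P : y \in T :&: P -> conn Q x y h.
  by rewrite in_setI => /andP[yT _]; apply: conn_mono UQ _; apply: hT.
have [g1|g1] := leqP g #|T :&: Q1|.
  exists (T :&: Q1); split => //; last by move=> y; apply: conv.
  by left; apply: subset_trans (subsetIr _ _) h1.
exists (T :&: Q2); split; last by move=> y; apply: conv.
- by right; apply: subset_trans (subsetIr _ _) h2.
- by rewrite cT in cTT; lia.
Qed.

(* The two bushes end on unknown sides of the pair [(U1, U2)]; meeting in [U3],
   which is joined to both sides, makes the length independent of the sides. *)
Lemma closing_gadget g h (U1 U2 U3 : {set V}) :
  [disjoint U1 & U2] -> [disjoint U1 & U3] -> [disjoint U2 & U3] ->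
  joined g U1 U2 -> joined g U1 U3 -> joined g U2 U3 ->
  42 * g <= #|U1| -> 42 * g <= #|U2| -> 2 * g <= #|U3| ->
  0 < g -> 2 * g <= 2 ^ h -> 2 ^ h.-1 <= 2 * g ->
  exists E Bad : {set V}, [/\ #|E| <= 86 * g, #|Bad| <= 4 * g &
    forall u v, u \in U1 :|: U2 -> u \notin Bad -> v \in U1 :|: U2 -> v \notin Bad ->
    exists x y, [/\ H u x, H y v & conn E x y (h + h + 2)]].
Proof.
move=> d12 d13 d23 j12 j13 j23 c1 c2 c3 g0 hh hh'.
have [W1 W1U cW1] := subset_of_card c1; have [W2 W2U cW2] := subset_of_card c2.
have [Q3 Q3U cQ3] := subset_of_card c3.
(* The [42 * g] vertices on each side are halved to give two disjoint reservoirs, one for each end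
   of the path. *)
have [A1 A1W cA1] : exists2 B : {set V}, B \subset W1 & #|B| = 21 * g by apply: subset_of_card; lia.
have [A2 A2W cA2] : exists2 B : {set V}, B \subset W2 & #|B| = 21 * g by apply: subset_of_card; lia.
have cB1 : #|W1 :\: A1| = 21 * g by rewrite cardsD (setIidPr A1W); lia.
have cB2 : #|W2 :\: A2| = 21 * g by rewrite cardsD (setIidPr A2W); lia.
have B1U := subset_trans (subsetDl W1 A1) W1U.
have B2U := subset_trans (subsetDl W2 A2) W2U.
have A1U := subset_trans A1W W1U; have A2U := subset_trans A2W W2U.
have [Qa [aQ a1 a2 ha]] := reservoir d12 j12 A1U A2U cA1 cA2 hh hh'.
have [Qb [bQ b1 b2 hb]] := reservoir d12 j12 B1U B2U cB1 cB2 hh hh'.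
have dab : [disjoint Qa & Qb].
  apply: (disjoint_sub _ aQ bQ); rewrite disjointUl !disjointUr.
  rewrite (disjoint_sub d12 A1U B2U) /= [X in _ && X]andbC.
  rewrite [[disjoint A2 & W1 :\: A1]]disjoint_sym (disjoint_sub d12 B1U A2U) /= !andbT.
  by rewrite -!setI_eq0 !setIDA ![_ :&: W1]setIC ![_ :&: W2]setIC -!setIDA !setDv !setI0 eqxx.
have d3 : [disjoint U1 :|: U2 & Q3].
  by rewrite disjointUl (disjoint_sub d13 (subxx _) Q3U) (disjoint_sub d23 (subxx _) Q3U).
have QaU : Qa \subset U1 :|: U2 by apply: subset_trans aQ (setUSS _ _).
have QbU : Qb \subset U1 :|: U2 by apply: subset_trans bQ (setUSS _ _).
exists (Qa :|: Q3 :|: Qb), ((U1 :\: nbhd Qa) :|: (U2 :\: nbhd Qa) :|: ((U1 :\: nbhd Qb) :|: (U2 :\: nbhd Qb))).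
split.
- have ca := leq_trans (subset_leq_card aQ) (card_setU_le _ _).
  have cb := leq_trans (subset_leq_card bQ) (card_setU_le _ _).
  apply: leq_trans (card_setU_le _ _) _; apply: leq_trans (leq_add (card_setU_le _ _) (leqnn _)) _.
  by move: ca cb; rewrite cQ3 cA1 cA2 cB1 cB2; clear; lia.
- apply: leq_trans (card_setU_le _ _) _.
  apply: leq_trans (leq_add (card_setU_le _ _) (card_setU_le _ _)) _.
  by move: a1 a2 b1 b2; clear; lia.
move=> u v uU uB vU vB.
have [x xQ ux] : exists2 x, x \in Qa & H u x.
  move: uU uB; rewrite !in_setU !in_setD.
  case: (boolP (u \in nbhd Qa)) => [/nbhdP[x xQ xu] _ _|_ /=].
    by exists x; rewrite // Hsym.
  by case: (u \in U1) => //= ->; rewrite ?orbT.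
have [y yQ vy] : exists2 y, y \in Qb & H v y.
  move: vU vB; rewrite !in_setU !in_setD.
  case: (boolP (v \in nbhd Qb)) => [/nbhdP[y yQ yv] _ _|_ /=].
    by exists y; rewrite // Hsym.
  case: (v \in U1) => /=; first by rewrite !orbT.
  by move=> ->; rewrite !orbT.
have far (T : {set V}) : T \subset U1 \/ T \subset U2 -> g <= #|T| -> #|Q3 :\: nbhd T| < g.
  by case=> sT gT; [exact: (joined_nbhd j13)|exact: (joined_nbhd j23)].
have [Ta [sTa gTa cTa]] := ha x xQ; have [Tb [sTb gTb cTb]] := hb y yQ.
(* Each leaf set misses fewer than [g] of the [2 * g] vertices of [Q3], so some [z] is adjacent to
   both. *)
have [z zQ] : exists z, z \in Q3 :\: ((Q3 :\: nbhd Ta) :|: (Q3 :\: nbhd Tb)).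
  apply/set0Pn; rewrite -card_gt0; apply: leq_trans (card_setD_ge _ _).
  move: (far _ sTa gTa) (far _ sTb gTb) (card_setU_le (Q3 :\: nbhd Ta) (Q3 :\: nbhd Tb)).
  by rewrite cQ3; clear; lia.
move: zQ; rewrite in_setD in_setU !in_setD => /andP[]; case: (boolP (z \in Q3)); last by rewrite andbF.
move=> zQ; rewrite !andbT negb_or !negbK => /andP[/nbhdP[a aT az] /nbhdP[b bT bz]] _.
exists x, y; split => //; first by rewrite Hsym.
have dz : [disjoint Qa & [set z]].
  by apply: (disjoint_sub d3) => //; rewrite sub1set.
have dz' : [disjoint Qa :|: [set z] & Qb].
  rewrite disjointUl dab /= disjoint_sym; apply: (disjoint_sub d3) => //.
  by rewrite sub1set.
have := conn_cat (cTa a aT) az (conn_refl H (set11 z)) dz.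
have zb : H z b by rewrite Hsym.
move=> /conn_cat /(_ zb (conn_sym Hsym (cTb b bT)) dz').
rewrite (_ : (_ + _).+1 = h + h + 2); last by clear; lia.
by apply: conn_mono; rewrite setSU // setUS // sub1set.
Qed.

End Closing.

(** * Traversing a tile *)

Section Traversal.
Variables (V : finType) (H : rel V).
Hypothesis Hsym : symmetric H.

Local Notation joined := (joined H).
Local Notation conn := (conn H).
Local Notation nbhd := (nbhd H).

(** Shrinking the support to the path itself lets the vertices consumed by greedy choices be
    counted. *)
Lemma conn_tight (D : {set V}) x y k :
  conn D x y k -> exists D' : {set V}, [/\ D' \subset D, #|D'| = k.+1 & conn D' x y k].
Proof.
case=> p [h1 h2 h3 h4 h5]; exists [set z in x :: p]; split.
- by apply/subsetP => z; rewrite inE => /h4.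
- by rewrite cardsE (card_uniqP h3) /= h5.
- by exists p; split => // z hz; rewrite inE.
Qed.

(** The deleted set [F] may also meet [X] and [U]; this robustness is what makes greedy choices of
    disjoint paths possible. *)
Definition accessible (f K : nat) (X U : {set V}) :=
  forall F : {set V}, #|F| <= f ->
  exists u v k, [/\ u \in X, v \in U, k <= K & conn (~: F) u v k].

(* [P x] is the support of the path chosen from [x] to [e x]. *)
Definition feeder (m K : nat) (X U D : {set V}) :=
  exists (S : {set V}) (e : V -> V) (P : V -> {set V}),
    [/\ S \subset X, #|S| = m,
        forall x, x \in S -> [/\ e x \in U, P x \subset D & exists2 k, k <= K & conn (P x) x (e x) k]
      & forall x y, x \in S -> y \in S -> x != y -> [disjoint P x & P y]].

(** Greedy choice: the paths found so far occupy at most [K.+1] vertices each and are deleted,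
    together with [F], before the next one is taken. *)
Lemma feeder_exists f K m (X U F : {set V}) :
  accessible f K X U -> #|F| + m * K.+1 <= f ->
  exists D, [/\ feeder m K X U D, [disjoint D & F] & #|D| <= m * K.+1].
Proof.
move=> acc; elim: m => [|m IH] hF.
  exists set0; split; rewrite ?cards0 //; last by rewrite -setI_eq0 set0I.
  by exists set0, id, (fun=> set0); rewrite sub0set cards0; split => // x; rewrite inE.
have [|D [[S [e [P [SX cS hS dS]]]] dD cD]] := IH; first by lia.
have [|u [v [k [uX vU kK c]]]] := acc (F :|: D).
  by apply: leq_trans (card_setU_le _ _) _; lia.
have [Q [QF cQ cc]] := conn_tight c.
have dQ : [disjoint F :|: D & Q] by rewrite disjoint_sym disjoints_subset.
have uD : u \notin D.
  have := conn_inl c; by rewrite !inE negb_or => /andP[].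
have SD x : x \in S -> x \in D.
  by case/hS => _ /subsetP sD [k' _ /conn_inl /sD].
have uS : u \notin S by apply: contra uD; apply: SD.
have neu x : x \in S -> (x == u) = false by move=> xS; apply: contraNF uS => /eqP <-.
exists (D :|: Q); split; first last.
- by apply: leq_trans (card_setU_le _ _) _; rewrite cQ; lia.
- by move: dQ; rewrite !disjointUl dD /= [[disjoint Q & F]]disjoint_sym => /andP[].
exists (u |: S), (fun z => if z == u then v else e z), (fun z => if z == u then Q else P z); split.
- by rewrite subUset sub1set uX.
- by rewrite cardsU1 uS cS.
- move=> x; rewrite in_setU1; case: eqP => [-> _|_ /= /hS[h1 h2 h3]].
    by split => //; [exact: subsetUr|exists k].
  by split => //; apply: subset_trans h2 (subsetUl _ _).
- have dP x : x \in S -> [disjoint P x & Q].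
    move=> /hS[_ h _]; move: dQ; rewrite disjointUl => /andP[_ h'].
    exact: disjoint_sub h' h (subxx _).
  move=> x y; rewrite !in_setU1; case: (eqVneq x u) => [->|_] /=.
    by move=> _ /predU1P[->|yS]; rewrite ?eqxx // neu // => _; rewrite disjoint_sym dP.
  by move=> xS /predU1P[->|yS]; rewrite ?eqxx ?neu // => ?; [apply: dP|apply: dS].
Qed.

(** For every tile one feeder for entering, one for leaving and a set [Z i] of link vertices are
    reserved greedily. Each of the three takes at most [2 * g * K.+1] vertices. *)
Lemma skeleton f K g q (X : nat -> {set V}) (U W F : {set V}) :
  (forall i, i < q -> accessible f K (X i) U) ->
  #|F| + q * (6 * g * K.+1) <= f -> f + 2 * g <= #|W| ->
  exists Z D1 D2 : nat -> {set V},
    [/\ forall i, i < q -> [/\ Z i \subset W, #|Z i| = 2 * g,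
          feeder (2 * g) K (X i) U (D1 i) & feeder (2 * g) K (X i) U (D2 i)],
        forall i, i < q -> [/\ [disjoint Z i & D1 i :|: D2 i], [disjoint D1 i & D2 i]
                             & [disjoint Z i :|: D1 i :|: D2 i & F]],
        forall i j, i < j < q -> [disjoint Z i :|: D1 i :|: D2 i & Z j :|: D1 j :|: D2 j]
      & #|\bigcup_(i < q) (Z i :|: D1 i :|: D2 i)| <= q * (6 * g * K.+1)].
Proof.
move=> acc; elim: q acc => [|q IH] acc hF hW.
  exists (fun=> set0), (fun=> set0), (fun=> set0).
  split => //; first by move=> i j; rewrite ltn0 andbF.
  by rewrite big_ord0 cards0.
have [|||Z [D1 [D2 [h1 h2 h3 h4]]]] := IH.
- by move=> i iq; apply: acc; apply: ltnW.
- by lia.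
- by [].
set E := \bigcup_(i < q) _ in h4.
have e6 : 6 * g * K.+1 = 2 * g * K.+1 + 2 * g * K.+1 + 2 * g * K.+1 by lia.
have e2 : 2 * g <= 2 * g * K.+1 by rewrite leq_pmulr.
rewrite mulSn e6 in hF *.
rewrite e6 in h4.
have [Zq ZW cZ] : exists2 B : {set V}, B \subset W :\: (F :|: E) & #|B| = 2 * g.
  apply: subset_of_card; apply: leq_trans (card_setD_ge _ _).
  have := card_setU_le F E; move=> /= ?; lia.
have [|D1q [fD1 dD1 cD1]] := @feeder_exists f K (2 * g) (X q) U (F :|: E :|: Zq) (acc q (ltnSn _)).
  by move: (card_setU_le (F :|: E) Zq) (card_setU_le F E) => /= ? ?; lia.
have [|D2q [fD2 dD2 cD2]] := @feeder_exists f K (2 * g) (X q) U (F :|: E :|: Zq :|: D1q) (acc q (ltnSn _)).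
  by move: (card_setU_le (F :|: E :|: Zq) D1q) (card_setU_le (F :|: E) Zq) (card_setU_le F E) => /= ? ? ?; lia.
pose up (A : nat -> {set V}) B i := if i == q then B else A i.
have upq A B : up A B q = B by rewrite /up eqxx.
have upi A B i : i < q -> up A B i = A i by move=> iq; rewrite /up ltn_eqF.
move: dD1; rewrite !disjointUr => /andP[/andP[dF1 dE1] dZ1].
move: dD2; rewrite !disjointUr => /andP[/andP[/andP[dF2 dE2] dZ2] d12].
have dZ : [disjoint Zq & F] && [disjoint Zq & E].
  rewrite -disjointUr; apply: disjointWl ZW _.
  exact: disjointDl.
exists (up Z Zq), (up D1 D1q), (up D2 D2q); split.
- move=> i; rewrite ltnS leq_eqVlt => /predU1P[->|iq]; last by rewrite !upi //; apply: h1.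
  by rewrite !upq; split => //; apply: subset_trans ZW (subsetDl _ _).
- move=> i; rewrite ltnS leq_eqVlt => /predU1P[->|iq]; last by rewrite !upi //; apply: h2.
  rewrite !upq !disjointUl dF1 dF2 disjointUr; case/andP: dZ => -> _.
  by rewrite ![[disjoint Zq & _]]disjoint_sym dZ1 dZ2 [[disjoint D1q & _]]disjoint_sym d12.
- move=> i j /andP[ij]; rewrite ltnS leq_eqVlt => /predU1P[jq|jq]; last first.
    have iq : i < q by apply: ltn_trans jq.
    by rewrite !upi //; apply: h3; rewrite ij.
  have iq : i < q by rewrite -jq.
  rewrite jq !upq !upi // disjoint_sym; apply: (@disjoint_sub _ (Zq :|: D1q :|: D2q) E) => //.
    by rewrite !disjointUl dE1 dE2; case/andP: dZ => _ ->.
  exact: (bigcup_sup (Ordinal iq)).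
- rewrite big_ord_recr /= !upq; apply: leq_trans (card_setU_le _ _) _.
  rewrite (eq_bigr (fun i : 'I_q => Z i :|: D1 i :|: D2 i)); last first.
    by move=> i _; rewrite !upi.
  rewrite -/E; move: (card_setU_le (Zq :|: D1q) D2q) (card_setU_le Zq D1q) => /= ? ?; lia.
Qed.

(** Only a window for the length is promised, since it depends on the chosen ports; the deviation is
    corrected later in the core. *)
Definition traversable (g : nat) (U D I O : {set V}) (lo hi : nat) :=
  [/\ I \subset U, O \subset U, g <= #|I|, g <= #|O| &
      forall c c', c \in I -> c' \in O -> exists2 k, lo <= k <= hi & conn D c c' k].

(** Fewer than [g] of the [2 * g] starting points miss [S]. The feeder paths are disjoint, so
    distinct starting points have distinct ends in [U]. *)
Lemma feeder_ports g K (X U D S : {set V}) :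
  0 < g -> feeder (2 * g) K X U D -> (forall S' : {set V}, S' \subset X -> #|S' :\: nbhd S| < g) ->
  exists I : {set V}, [/\ I \subset U, g <= #|I| &
    forall c, c \in I -> exists x s k, [/\ x \in X, s \in S, H s x, k <= K & conn D x c k]].
Proof.
move=> g0 [T [e [P [TX cT hT dT]]]] hS.
exists (e @: (T :&: nbhd S)); split.
- apply/subsetP => c /imsetP[x]; rewrite in_setI => /andP[xT _] ->.
  by case: (hT x xT).
- rewrite card_in_imset; first by have := hS T TX; rewrite cardsD; lia.
  move=> x y; rewrite !in_setI => /andP[xT _] /andP[yT _] exy.
  apply/eqP; apply/negPn/negP => nxy; have := dT x y xT yT nxy.
  have [_ _ [k _ /conn_inr ex]] := hT x xT; have [_ _ [k' _ /conn_inr ey]] := hT y yT.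
  by move=> /disjointFr /(_ ex); rewrite exy ey.
- move=> c /imsetP[x]; rewrite in_setI => /andP[xT /nbhdP[s sS sx]] ->.
  have [_ PD [k kK c']] := hT x xT; exists x, s, k; split => //.
    exact: (subsetP TX).
  exact: conn_mono PD c'.
Qed.

(** The long alternating path misses at most [4 * g] vertices of the tile. It is entered among its
    first [2 * g] vertices and left among its last [2 * g], which accounts for the [8 * g]; the two
    feeder paths and two linking edges account for [K.*2 + 2]. *)
Lemma piece_traversable g K m (X Y X' Y' U D1 D2 : {set V}) :
  0 < g -> [disjoint X & Y] -> joined g X Y -> X' \subset X -> Y' \subset Y ->
  #|X'| = m -> #|Y'| = m -> 4 * g <= m ->
  feeder (2 * g) K X U D1 -> feeder (2 * g) K X U D2 ->
  [disjoint D1 & D2] -> [disjoint D1 :|: D2 & X' :|: Y'] ->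
  exists I O, traversable g U (D1 :|: (X' :|: Y') :|: D2) I O (m.*2 - 8 * g) (m.*2 + K.*2 + 2).
Proof.
move=> g0 d j XX YY cX cY gm f1 f2 d12 dD.
have d' := disjoint_sub d XX YY.
have [p [sp up pXY szp]] := long_bip_path Hsym d' (joined_sub j XX YY) cX cY.
have spH : sorted H p by apply: sub_sorted sp => x y; apply: bip_sub.
have x0 : V by case: p szp {sp up pXY spH} => [|a p _]; [rewrite /=; lia|exact: a].
have szp2 : size p <= m.*2.
  have : #|[set z in p]| <= #|X' :|: Y'|.
    by apply: subset_leq_card; apply/subsetP => z; rewrite inE => /pXY.
  by rewrite cardsE (card_uniqP up) (card_disjointU d') cX cY addnn.
have seg (r : seq V) : sorted (bip H X' Y') r -> uniq r -> {subset r <= p} -> size r = g.*2 ->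
    forall S' : {set V}, S' \subset X -> #|S' :\: nbhd [set y in Y' | y \in r]| < g.
  move=> sr ur rp szr S' S'X.
  have rXY : {subset r <= X' :|: Y'} by move=> z /rp /pXY.
  have [cr _] := bip_segment d' sr rXY szr ur.
  apply: (joined_nbhd (joined_sym Hsym j) _ S'X); last by rewrite cr.
  by apply: subset_trans YY; apply/subsetP => z; rewrite inE => /andP[].
have tk : size (take g.*2 p) = g.*2 by rewrite size_takel //; lia.
have dr : size (drop (size p - g.*2) p) = g.*2 by rewrite size_drop; lia.
have [I [IU gI hI]] := feeder_ports g0 f1
  (seg _ (take_sorted _ sp) (take_uniq _ up) (@mem_take _ _ _) tk).
have [O [OU gO hO]] := feeder_ports g0 f2
  (seg _ (drop_sorted _ sp) (drop_uniq _ up) (@mem_drop _ _ _) dr).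
exists I, O; split => // c c' cI c'O.
have [x [s [k1 [xX]]]] := hI c cI; rewrite inE => /andP[sY sr] sx k1K con1.
have [y [t [k2 [yX]]]] := hO c' c'O; rewrite inE => /andP[tY tr] ty k2K con2.
have hi : index s p < g.*2 by rewrite index_ltn.
have hj : size p - g.*2 <= index t p < size p.
  rewrite index_mem (mem_drop tr) andbT leqNgt; apply/negP => lt.
  have tt : t \in take (size p - g.*2) p by rewrite in_take // (mem_drop tr).
  move: up; rewrite -(cat_take_drop (size p - g.*2) p) cat_uniq => /and3P[_ /hasP[]].
  by exists t.
have con : conn (X' :|: Y') s t (index t p - index s p).
  rewrite -[X in conn _ X _ _](nth_index x0 (mem_take sr)) -[X in conn _ _ X _](nth_index x0 (mem_drop tr)).
  have ij : index s p <= index t p < size p by move: hi hj szp gm; clear; lia.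
  apply: conn_mono (conn_seq x0 spH up ij).
  by apply/subsetP => z; rewrite inE => /pXY.
move: dD; rewrite disjointUl => /andP[dD1 dD2].
have xs : H x s by rewrite Hsym.
have c1 := conn_cat (conn_sym Hsym con1) xs con dD1.
have c2 := conn_cat c1 ty con2 _.
eexists; last by apply: c2; rewrite disjointUl d12 disjoint_sym dD2.
by move: k1K k2K hi hj szp szp2 gm; clear; lia.
Qed.

(** Exits and entrances both lie in [U], hence are linked through a vertex of [Z]: fewer than [g] of
    its [2 * g] vertices miss [O1], and fewer than [g] miss [I2]. *)
Lemma traversable_cat g (U W D1 D2 Z I1 O1 I2 O2 : {set V}) lo1 hi1 lo2 hi2 :
  0 < g -> joined g U W -> Z \subset W -> #|Z| = 2 * g ->
  traversable g U D1 I1 O1 lo1 hi1 -> traversable g U D2 I2 O2 lo2 hi2 ->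
  [disjoint D1 & Z] -> [disjoint D1 :|: Z & D2] ->
  traversable g U (D1 :|: Z :|: D2) I1 O2 (lo1 + lo2) (hi1 + hi2 + 2).
Proof.
move=> g0 j ZW cZ [a1 a2 a3 a4 a5] [b1 b2 b3 b4 b5] d1 d2; split => //.
move=> c c' cI cO.
have [z] : exists z, z \in Z :\: ((Z :\: nbhd O1) :|: (Z :\: nbhd I2)).
  apply/set0Pn; rewrite -card_gt0; apply: leq_trans (card_setD_ge _ _).
  have := joined_nbhd j a2 ZW a4; have := joined_nbhd j b1 ZW b3.
  move: (card_setU_le (Z :\: nbhd O1) (Z :\: nbhd I2)); rewrite cZ; clear; lia.
rewrite in_setD in_setU !in_setD => /andP[]; case: (boolP (z \in Z)); last by rewrite andbF.
move=> zZ; rewrite !andbT negb_or !negbK => /andP[/nbhdP[o oO oz] /nbhdP[i iI iz]] _.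
have [k1 hk1 c1] := a5 c o cI oO; have [k2 hk2 c2] := b5 i c' iI cO.
have dz : [disjoint D1 & [set z]] by apply: (disjoint_sub d1) => //; rewrite sub1set.
have zi : H z i by rewrite Hsym.
have c3 := conn_cat c1 oz (conn_refl H (set11 z)) dz.
have c4 := conn_cat c3 zi c2.
exists ((k1 + 0).+1 + k2).+1; first by move: hk1 hk2; clear; lia.
apply: conn_mono (c4 _); first by rewrite setSU // setUS // sub1set.
by apply: (disjoint_sub d2) => //; rewrite setUS // sub1set.
Qed.

End Traversal.

(** * Cycles of prescribed length *)

Section Embedding.
Variables (V : finType) (H : rel V).
Hypothesis Hsym : symmetric H.

Local Notation joined := (joined H).
Local Notation conn := (conn H).

Lemma pigeonhole_avoid M (u v : nat -> V) (B : {set V}) :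
  (forall i j, i < M -> j < M -> u i = u j -> i = j) ->
  (forall i j, i < M -> j < M -> v i = v j -> i = j) ->
  2 * #|B| < M -> exists d, [/\ d < M, u d \notin B & v d \notin B].
Proof.
move=> iu iv hB.
have pre (w : nat -> V) : (forall i j, i < M -> j < M -> w i = w j -> i = j) ->
    #|[set d : 'I_M | w d \in B]| <= #|B|.
  move=> iw; rewrite -(card_in_imset (f := fun d : 'I_M => w d)).
    by apply: subset_leq_card; apply/subsetP => x /imsetP[d]; rewrite inE => ? ->.
  by move=> d e _ _ /iw h; apply: val_inj; apply: h.
have [d] : exists d : 'I_M, d \in ~: ([set d : 'I_M | u d \in B] :|: [set d : 'I_M | v d \in B]).
  apply/set0Pn; rewrite -card_gt0 -setTD; apply: leq_trans (card_setD_ge _ _).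
  rewrite cardsT card_ord subn_gt0; apply: leq_ltn_trans (card_setU_le _ _) _.
  by move: (pre u iu) (pre v iv) hB; clear; lia.
by rewrite !inE negb_or => /andP[h1 h2]; exists d.
Qed.

Lemma setU_rearrange (A B C D W : {set V}) :
  D \subset W -> A :|: (B :|: D :|: C) \subset A :|: B :|: C :|: W.
Proof.
move=> /subsetP sD; apply/subsetP => x; rewrite !in_setU.
case: (x \in A) => //=; case: (x \in B) => //=; case: (x \in C); rewrite ?orbT ?orbF //=.
exact: sD.
Qed.

(** Here [h] is the depth of the closing trees, [f] the number of vertices that may be deleted, [K]
    the bound on connecting paths, [N] the core size, and the [q] tiles have sides of size [s]. *)
Variables (g h f K N s q : nat) (X Y : nat -> {set V}) (U1 U2 U3 : {set V}).
Hypotheses (g0 : 0 < g) (hh : 2 * g <= 2 ^ h) (hh' : 2 ^ h.-1 <= 2 * g).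
Hypotheses (d12 : [disjoint U1 & U2]) (d13 : [disjoint U1 & U3]) (d23 : [disjoint U2 & U3]).
Hypotheses (j12 : joined g U1 U2) (j13 : joined g U1 U3) (j23 : joined g U2 U3).
Hypotheses (cU1 : N <= #|U1|) (cU2 : N <= #|U2|) (cU3 : 2 * g <= #|U3|).
Hypothesis hXY : forall i, i < q ->
  [/\ [disjoint X i & Y i], joined g (X i) (Y i), #|X i| = s, #|Y i| = s
    & [disjoint X i :|: Y i & U1 :|: U2]].
Hypothesis hacc : forall i, i < q -> accessible H f K (X i) U1.
Hypothesis hdis : forall i j, i < j < q -> [disjoint X i :|: Y i & X j :|: Y j].
Hypotheses (hf : 100 * g * q.+1 * K.+1 <= f) (hs : 2 * f <= s) (hN : 8 * s + 8 * q.+1 * f <= N).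

Let lo := (s - f).*2 - 8 * g.
Let hi := (s - f).*2 + K.*2 + 2.

(** Each tile is trimmed to [s - f] vertices a side outside [F], which contains everything reserved;
    the links, feeders and trimmed tiles are then pairwise disjoint. [Z k.+1] links tile [k.+1] to
    the chain before it. *)
Lemma chain_pieces (Z D1 D2 : nat -> {set V}) (F : {set V}) :
  (forall i, i < q -> [/\ Z i \subset U2, #|Z i| = 2 * g,
     feeder H (2 * g) K (X i) U1 (D1 i) & feeder H (2 * g) K (X i) U1 (D2 i)]) ->
  (forall i, i < q -> [/\ [disjoint Z i & D1 i :|: D2 i], [disjoint D1 i & D2 i]
                        & Z i :|: D1 i :|: D2 i \subset F]) ->
  (forall i j, i < j < q -> [disjoint Z i :|: D1 i :|: D2 i & Z j :|: D1 j :|: D2 j]) ->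
  #|F| <= f -> forall k, k < q ->
  exists D I O, traversable H g U1 D I O (k.+1 * lo) (k.+1 * (hi + 2)) /\
    D \subset \bigcup_(i < q) (Z i :|: D1 i :|: D2 i :|: ((X i :|: Y i) :\: F)).
Proof.
move=> h1 h2 h3 cF.
have g4 : 4 * g <= s - f by move: hf hs; clear; nia.
pose X' i := trim (s - f) (X i :\: F); pose Y' i := trim (s - f) (Y i :\: F).
have X'X i : X' i \subset X i by apply: subset_trans (trim_sub _ _) (subsetDl _ _).
have Y'Y i : Y' i \subset Y i by apply: subset_trans (trim_sub _ _) (subsetDl _ _).
have X'F i : [disjoint X' i & F].
  by apply: disjointWl (trim_sub _ _) _; apply: disjointDl.
have Y'F i : [disjoint Y' i & F].
  by apply: disjointWl (trim_sub _ _) _; apply: disjointDl.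
have cX' i : i < q -> #|X' i| = s - f.
  move=> /hXY[_ _ cX _ _]; apply: trim_card; apply: leq_trans (card_setD_ge _ _).
  by rewrite cX leq_sub2l.
have cY' i : i < q -> #|Y' i| = s - f.
  move=> /hXY[_ _ _ cY _]; apply: trim_card; apply: leq_trans (card_setD_ge _ _).
  by rewrite cY leq_sub2l.
pose B i := Z i :|: (D1 i :|: (X' i :|: Y' i) :|: D2 i).
have BE i : i < q -> B i \subset Z i :|: D1 i :|: D2 i :|: ((X i :|: Y i) :\: F).
  move=> iq; have sX : X' i :|: Y' i \subset (X i :|: Y i) :\: F.
    by rewrite subsetD setUSS //= disjointUl X'F Y'F.
  exact: setU_rearrange.
have dXF i : [disjoint X' i :|: Y' i & F] by rewrite disjointUl X'F Y'F.
have piece i : i < q -> exists I O, traversable H g U1 (D1 i :|: (X' i :|: Y' i) :|: D2 i) I O lo hi.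
  move=> iq; have [dXY jXY _ _ _] := hXY iq; have [_ _ f1 f2] := h1 i iq; have [_ d dF] := h2 i iq.
  apply: (piece_traversable Hsym g0 dXY jXY (X'X i) (Y'Y i) (cX' i iq) (cY' i iq) g4 f1 f2 d).
  rewrite disjoint_sym; apply: disjoint_sub (dXF i) (subxx _) _.
  by apply: subset_trans dF; rewrite -setUA subsetUr.
have dB i j : i < j -> j < q -> [disjoint B i & B j].
  move=> ij jq; have iq := ltn_trans ij jq; have ijq : i < j < q by rewrite ij.
  have s1 l : B l \subset (Z l :|: D1 l :|: D2 l) :|: (X' l :|: Y' l).
    exact: setU_rearrange.
  have [_ _ dFi] := h2 i iq; have [_ _ dFj] := h2 j jq.
  apply: (disjoint_sub _ (s1 i) (s1 j)); rewrite disjointUl.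
  apply/andP; split; rewrite disjointUr; apply/andP; split.
  - exact: h3.
  - by rewrite disjoint_sym; apply: disjoint_sub (dXF j) (subxx _) dFi.
  - exact: disjoint_sub (dXF i) (subxx _) dFj.
  - by apply: (disjoint_sub (hdis ijq)); apply: setUSS.
suff main k : k < q -> exists D I O, traversable H g U1 D I O (k.+1 * lo) (k.+1 * (hi + 2)) /\
    D \subset \bigcup_(i < k.+1) B i.
  move=> k kq; have [D [I [O [tD sD]]]] := main k kq; exists D, I, O; split => //.
  apply: subset_trans sD _; apply/bigcupsP => i _.
  have iq : i < q by apply: leq_trans kq.
  by apply: subset_trans (BE _ iq) (bigcup_sup (Ordinal iq) _).
elim: k => [|k IH] kq.
  have [I [O [t1 t2 t3 t4 t5]]] := piece 0 kq.
  exists (D1 0 :|: (X' 0 :|: Y' 0) :|: D2 0), I, O; split; last first.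
    by rewrite big_ord1 /B subsetUr.
  split => // c c' cI cO; have [l hl c5] := t5 c c' cI cO; exists l => //.
  by rewrite !mul1n; move: hl; clear; lia.
have [D [I [O [tD sD]]]] := IH (ltnW kq); have [I' [O' tD']] := piece _ kq.
have [ZU cZ _ _] := h1 _ kq; have [dZ dD12 dF] := h2 _ kq.
have dDB : [disjoint D & B k.+1].
  apply: disjointWl sD _; rewrite disjoint_sym; apply: bigcup_disjoint => i _.
  by rewrite disjoint_sym; apply: dB.
have dDZ : [disjoint D & Z k.+1] by apply: disjointWr dDB; apply: subsetUl.
have dDZ' : [disjoint D :|: Z k.+1 & D1 k.+1 :|: (X' k.+1 :|: Y' k.+1) :|: D2 k.+1].
  rewrite disjointUl (disjointWr _ dDB) ?subsetUr //=.
  move: dZ; rewrite !disjointUr => /andP[-> ->] /=; rewrite andbT -disjointUr disjoint_sym.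
  apply: disjoint_sub (dXF _) (subxx _) _.
  by apply: subset_trans dF; rewrite -setUA subsetUl.
have := traversable_cat Hsym g0 j12 ZU cZ tD tD' dDZ dDZ'.
rewrite -mulSnr -addnA -mulSnr => tnew; do 3 eexists; split; first exact: tnew.
by rewrite big_ord_recr /= {2}/B -setUA setUSS.
Qed.

(* The ends of a path through suitably many tiles can be moved inside its two
   core segments; each of the at most [4 g] bad vertices excludes at most one
   position of either end, so some admissible position has two good ends. *)
Lemma embedding t : 2 * h + 5 <= t -> t + N <= 2 * (q * s) -> has_cycle H t.
Proof.
move=> ht tN.
have f1 : 86 * g + q * (6 * g * K.+1) <= f by move: hf; clear; nia.
have f2 : 2 * K + 4 + 8 * g <= f.
  by apply: leq_trans hf; have := leq_pmull K g0; move: g0; clear; nia.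
have f3 : 100 * g <= f by move: hf; clear; nia.
have N1 : 8 * s + 8 * f + 8 * (q * f) <= N by move: hN; clear; nia.
have [E [Bad [cE cBad close]]] : exists E Bad : {set V}, [/\ #|E| <= 86 * g, #|Bad| <= 4 * g &
    forall u v, u \in U1 :|: U2 -> u \notin Bad -> v \in U1 :|: U2 -> v \notin Bad ->
    exists x y, [/\ H u x, H y v & conn E x y (h + h + 2)]].
  apply: (closing_gadget Hsym d12 d13 d23 j12 j13 j23) => //.
    by apply: leq_trans cU1; move: f3 N1; clear; lia.
  by apply: leq_trans cU2; move: f3 N1; clear; lia.
have [||Z [D1 [D2 [h1 h2 h3 h4]]]] := @skeleton _ H f K g q X U1 U2 E hacc.
- by move: cE f1; clear; lia.
- by move: cU2 f3 N1; clear; lia.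
set EE := \bigcup_(i < q) _ in h4.
(* All that is reserved: the closing gadget [E], then the feeders and links of all tiles. *)
pose F := E :|: EE.
have cF : #|F| <= f.
  by apply: leq_trans (card_setU_le _ _) _; move: cE h4 f1; clear; lia.
have EEF i : i < q -> Z i :|: D1 i :|: D2 i \subset F.
  move=> iq; apply: subset_trans _ (subsetUr _ _); exact: (bigcup_sup (Ordinal iq)).
have chain := @chain_pieces Z D1 D2 F h1 _ h3 cF.
have {}chain k : k < q -> exists D I O,
    [/\ traversable H g U1 D I O (k.+1 * lo) (k.+1 * (hi + 2)), [disjoint D & E]
      & [disjoint D & (U1 :|: U2) :\: F]].
  move=> kq; have [|D [I [O [tD sD]]]] := chain _ k kq.
    by move=> i iq; have [a b c] := h2 i iq; split => //; apply: EEF.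
  exists D, I, O; split => //; apply: disjointWl sD _; rewrite disjoint_sym;
    apply: bigcup_disjoint => i _; rewrite disjoint_sym disjointUl; apply/andP; split.
  - by have [] := h2 i (ltn_ord i).
  - by apply: (disjoint_sub (disjointDl _ F)) (subxx _) (subsetUl _ _).
  - apply: disjointWl (EEF _ (ltn_ord i)) _.
    by rewrite disjoint_sym disjointDl.
  - by have [_ _ _ _ dU] := hXY (ltn_ord i); apply: disjoint_sub dU (subsetDl _ _) (subsetDl _ _).
pose m := N - f.
pose A1 := trim m (U1 :\: F); pose A2 := trim m (U2 :\: F).
have sA1 : A1 \subset U1 by apply: subset_trans (trim_sub _ _) (subsetDl _ _).
have sA2 : A2 \subset U2 by apply: subset_trans (trim_sub _ _) (subsetDl _ _).
have cA1 : #|A1| = m.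
  by apply: trim_card; apply: leq_trans (card_setD_ge _ _); apply: leq_sub.
have cA2 : #|A2| = m.
  by apply: trim_card; apply: leq_trans (card_setD_ge _ _); apply: leq_sub.
have dA := disjoint_sub d12 sA1 sA2.
have [p [sp up pA szp]] := long_bip_path Hsym dA (joined_sub j12 sA1 sA2) cA1 cA2.
have spH : sorted H p by apply: sub_sorted sp => x y; apply: bip_sub.
have pUF z : z \in p -> z \in (U1 :|: U2) :\: F.
  move=> /pA; apply/subsetP; rewrite subUset; apply/andP; split.
    by apply: subset_trans (trim_sub _ _) _; apply: setSD; apply: subsetUl.
  by apply: subset_trans (trim_sub _ _) _; apply: setSD; apply: subsetUr.
have pU z : z \in p -> z \in U1 :|: U2 by move=> /pUF; rewrite in_setD => /andP[].
have pE (r : seq V) : {subset r <= p} -> [disjoint [set z in r] & E].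
  move=> rp; rewrite disjoints_subset; apply/subsetP => z; rewrite inE => /rp /pUF.
  by rewrite !inE negb_or => /andP[/andP[]].
(* Half the guaranteed length [2 * m - 4 * g] of the path in what is left of the core. *)
pose l := m - 2 * g.
have szl : 2 * l <= size p by move: szp; rewrite /l; clear; lia.
have x0 : V by case: p szp {sp up pA spH pUF pU pE szl} => [|a p _]; [rewrite /= /m; move: f3 g0 N1; clear; lia|exact: a].
have finish (P : {set V}) u v k : conn P v u k -> [disjoint P & E] ->
    u \in p -> v \in p -> u \notin Bad -> v \notin Bad ->
    k + 2 * h + 4 = t -> has_cycle H t.
  move=> c dP up' vp uB vB <-; have [x [y [ux yv cxy]]] := close u v (pU _ up') uB (pU _ vp) vB.
  have := conn_cycle (conn_cat c ux cxy dP) yv.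
  by rewrite (_ : (k + _).+2 = k + 2 * h + 4) //; clear; lia.
have inj i j : i < size p -> j < size p -> nth x0 p i = nth x0 p j -> i = j.
  by move=> ip jp /eqP; rewrite nth_uniq // => /eqP.
(* Short cycles use the core path alone: the closing path with its two edges contributes
   [2 * h + 4], and the remaining segment can be shifted to [8 * g + 1] positions. *)
have [small|large] := leqP (t + 8 * g) (2 * l + 2 * h + 3).
  pose k := t - (2 * h + 4).
  have [|||d [dM uB vB]] := @pigeonhole_avoid (8 * g).+1 (fun d => nth x0 p (d + k)) (nth x0 p) Bad.
  - move=> i j iM jM /inj e; apply: (@addIn k).
    by apply: e; move: iM jM szl small ht; rewrite /k; clear; lia.
  - by move=> i j iM jM /inj; apply; move: iM jM szl small ht; clear; lia.
  - by move: cBad; clear; lia.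
  have dk : d <= d + k < size p by move: dM szl small ht; rewrite /k; clear; lia.
  apply: finish (conn_seq x0 spH up dk) (pE p _) _ _ uB vB _ => //.
  - by apply: mem_nth; case/andP: dk.
  - by apply: mem_nth; case/andP: dk => h5; apply: leq_ltn_trans.
  - by move: ht; rewrite /k; clear; lia.
pose lo' := lo; pose hi' := hi + 2.
(* Closing takes [2 * h + 4] edges and attaching the chain to the core path takes two; [8 * g] are
   kept for moving the ends. *)
pose t0 := t - (2 * h + 6 + 8 * g).
(* As many tiles as fit even when every traversal has its greatest length. *)
pose q' := minn q (t0 %/ hi').
have hi0 : 0 < hi' by rewrite /hi' addn2.
have hi_le : hi' <= 2 * s + f by move: f2 hs; rewrite /hi' /hi; clear; lia.
have lohi : hi' <= lo + f by move: f2 f3 hs; rewrite /hi' /hi /lo; clear; lia.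
have lo_ge : 2 * s <= lo + 3 * f by move: f3 hs; rewrite /lo; clear; lia.
have q0 : 0 < q by case: (q) tN N1 hs f3 g0 => //; clear; lia.
have t0_ge : hi' <= t0.
  by move: hi_le large N1 f3 ht; rewrite /t0 /l /m; clear; lia.
have q'0 : 0 < q' by rewrite leq_min q0 divn_gt0.
have q'q : q' <= q by apply: geq_minl.
have lower : q' * hi' <= t0.
  by apply: leq_trans (leq_trunc_div t0 hi'); rewrite leq_mul2r geq_minr orbT.
(* Even the shortest traversal leaves no more than two core segments can supply: either all tiles
   are used and [t + N <= 2 * (q * s)] applies, or one more tile could overshoot, and the lengths
   vary by at most [f] per tile. *)
have upper : t0 + 20 * g <= q' * lo + 2 * l.
  rewrite /q'; have [qt|tq] := leqP q (t0 %/ hi').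
    have : q * (2 * s) <= q * (lo + 3 * f) by rewrite leq_mul2l lo_ge orbT.
    by move: tN N1 f3; rewrite /t0 /l /m; clear; lia.
  set r := t0 %/ hi' in tq *.
  have r1 : t0 < r.+1 * hi' by rewrite ltn_ceil.
  have r2 : r * hi' <= r * lo + q * f.
    by apply: (@leq_trans (r * (lo + f))); [rewrite leq_mul2l lohi orbT|rewrite mulnDr leq_add2l leq_mul2r (ltnW tq) orbT].
  by move: r1 r2 hi_le N1 f3; rewrite mulSn /l /m; clear; lia.
have [|D [I [O [[IU OU gI gO tD] dDE dDp]]]] := chain q'.-1; first by rewrite prednK.
rewrite prednK // in tD.
have l20 : 20 * g <= l by move: N1 f3; rewrite /l /m; clear; lia.
have l2g : 2 * g <= l by move: N1 f3; rewrite /l /m; clear; lia.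
(* The chain is attached near the end of [pa] and near the start of [pb]. *)
pose pa := take l p; pose pb := drop l p.
have pap : {subset pa <= p} by move=> z /mem_take.
have pbp : {subset pb <= p} by move=> z /mem_drop.
have sza : size pa = l by rewrite size_takel //; move: szl; clear; lia.
have szb : l <= size pb by rewrite size_drop; move: szl; clear; lia.
have dab : [disjoint [set z in pa] & [set z in pb]].
  rewrite -setI_eq0 -subset0; apply/subsetP => z; rewrite !inE => /andP[za zb].
  by move: up; rewrite -(cat_take_drop l p) cat_uniq => /and3P[_ /hasP[]]; exists z.
have dDr (r : seq V) : {subset r <= p} -> [disjoint D & [set z in r]].
  move=> rp; apply: disjointWr dDp; apply/subsetP => z; rewrite inE => /rp; exact: pUF.
have seg (r : seq V) : sorted (bip H A1 A2) r -> uniq r -> {subset r <= p} -> size r = g.*2 ->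
    forall C : {set V}, C \subset U1 -> g <= #|C| -> exists y c, [/\ y \in r, c \in C & H y c].
  move=> sr ur rp szr C CU gC.
  have rA : {subset r <= A1 :|: A2} by move=> z /rp /pA.
  have [cr _] := bip_segment dA sr rA szr ur.
  have [||c [y [cC]]] := j12 CU (_ : [set y in A2 | y \in r] \subset U2) gC.
  - by apply: subset_trans sA2; apply/subsetP => z; rewrite inE => /andP[].
  - by rewrite cr.
  - by rewrite inE => /andP[_ yr] cy; exists y, c; rewrite Hsym.
have spa : sorted (bip H A1 A2) pa by apply: take_sorted.
have spb : sorted (bip H A1 A2) pb by apply: drop_sorted.
have [ya [c [ya1 cI yac]]] := seg (drop (l - g.*2) pa) (drop_sorted _ spa) (drop_uniq _ (take_uniq _ up))
  (fun z hz => pap z (mem_drop hz)) ltac:(by rewrite size_drop sza; move: l2g; clear; lia) I IU gI.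
have [yb [c' [yb1 cO ybc]]] := seg (take g.*2 pb) (take_sorted _ spb) (take_uniq _ (drop_uniq _ up))
  (fun z hz => pbp z (mem_take hz)) ltac:(by rewrite size_takel //; move: l2g szb; clear; lia) O OU gO.
have [mu hmu cmu] := tD c c' cI cO.
pose x := index ya pa; pose y := index yb pb.
have yapa : ya \in pa by apply: mem_drop ya1.
have ybpb : yb \in pb by apply: mem_take yb1.
have hx : l - 2 * g <= x < l.
  rewrite -{2}sza index_mem yapa andbT leqNgt; apply/negP => lt.
  have tt : ya \in take (l - g.*2) pa by rewrite in_take // -mul2n.
  have : uniq pa by apply: take_uniq.
  rewrite -(cat_take_drop (l - g.*2) pa) cat_uniq => /and3P[_ /hasP[]].
  by exists ya.
have hy : y < 2 * g by rewrite mul2n index_ltn.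
pose kap := t - (2 * h + 6 + mu).
(* Of the [kap] missing edges, [d] are taken backwards in [pa] and [kap - d] forwards in [pb]; [d0]
   is the least [d] that keeps the second part within the first [l] vertices of [pb]. *)
pose d0 := kap - (l - 1 - y).
have kap1 : 8 * g <= kap.
  have mu1 : mu <= t0 by case/andP: hmu => _ /leq_trans; apply.
  by move: mu1 (leq_trans hi0 t0_ge); rewrite /kap /t0; clear; lia.
have kap2 : kap + 12 * g <= 2 * l.
  by case/andP: hmu => mu1 _; move: l20 mu1 upper t0_ge hi0; rewrite /kap /t0; move: (q' * lo) => Q; clear; lia.
have dd e : e < (8 * g).+1 -> d0 + e <= x /\ d0 + e <= kap /\ kap - (d0 + e) + y < l.
  by move: hx hy kap1 kap2 g0 l20; rewrite /d0; clear; lia.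
have upa : uniq pa by apply: take_uniq.
have upb : uniq pb by apply: drop_uniq.
have cancel a b c0 i j : a + i <= b -> a + j <= b ->
    c0 + (b - (a + i)) = c0 + (b - (a + j)) -> i = j by clear; lia.
have [|||e [eM uB vB]] := @pigeonhole_avoid (8 * g).+1 (fun e => nth x0 pa (x - (d0 + e)))
    (fun e => nth x0 pb (y + (kap - (d0 + e)))) Bad.
- move=> i j /dd[ix [ik il]] /dd[jx [jk jl]] /eqP; rewrite nth_uniq // => [/eqP||].
  + by move: ix jx; clear; lia.
  + by move: hx ix; rewrite sza; clear; lia.
  + by move: hx jx; rewrite sza; clear; lia.
- move=> i j /dd[ix [ik il]] /dd[jx [jk jl]] /eqP; rewrite nth_uniq // => [/eqP||].
  + exact: cancel.
  + by rewrite addnC; apply: leq_trans szb.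
  + by rewrite addnC; apply: leq_trans szb.
- by move: cBad; clear; lia.
have [ex [ek el]] := dd e eM; set d := d0 + e in ex ek el uB vB.
have spaH : sorted H pa by apply: take_sorted.
have spbH : sorted H pb by apply: drop_sorted.
have ha : x - d <= x < size pa by rewrite sza; move: hx; clear; lia.
have hb : y <= y + (kap - d) < size pb by rewrite leq_addr addnC; apply: leq_trans szb.
have ca := conn_seq x0 spaH upa ha; have cb := conn_seq x0 spbH upb hb.
rewrite [nth x0 pa x]nth_index // in ca; rewrite [nth x0 pb y]nth_index // in cb.
have c1 := conn_cat ca yac cmu _.
have {}c1 : conn ([set z in pa] :|: D) (nth x0 pa (x - d)) c' ((x - (x - d) + mu).+1).
  by apply: c1; rewrite disjoint_sym; apply: dDr.
have cyb : H c' yb by rewrite Hsym.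
have d2 : [disjoint [set z in pa] :|: D & [set z in pb]].
  by rewrite disjointUl dab; apply: dDr.
have c2 := conn_cat c1 cyb cb d2.
have dE : [disjoint [set z in pa] :|: D :|: [set z in pb] & E].
  by rewrite !disjointUl dDE !pE.
have pad : nth x0 pa (x - d) \in p by apply/pap/mem_nth; case/andP: ha => h5 h6; apply: leq_ltn_trans h6.
have pbd : nth x0 pb (y + (kap - d)) \in p by apply/pbp/mem_nth; case/andP: hb.
apply: (finish _ _ _ _ c2 dE pbd pad vB uB).
by move: ex ek hx kap1 g0; rewrite /kap; clear; lia.
Qed.

End Embedding.

(** * Tilings and robust components *)

Section Tilings.
Variables (V : finType) (H : rel V).
Hypothesis Hsym : symmetric H.

Inductive tiled (g s : nat) : {set V} -> nat -> Prop :=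
| tiled0 : tiled g s set0 0
| tiledS (X Y D : {set V}) q :
    [disjoint X & Y] -> [disjoint X :|: Y & D] -> joined H g X Y ->
    #|X| = s -> #|Y| = s -> tiled g s D q -> tiled g s (X :|: Y :|: D) q.+1.

Definition blob (g : nat) (D : {set V}) :=
  forall A B : {set V}, A \subset D -> B \subset D -> [disjoint A & B] ->
  g <= #|A| -> g <= #|B| -> exists a b, [/\ a \in A, b \in B & H a b].

Lemma blob_joined g (D X Y : {set V}) :
  blob g D -> X \subset D -> Y \subset D -> [disjoint X & Y] -> joined H g X Y.
Proof.
move=> bD XD YD d A B AX BY; apply: bD; last exact: disjoint_sub d AX BY.
  exact: subset_trans XD.
exact: subset_trans YD.
Qed.

Lemma blob_leq g g' (D : {set V}) : g <= g' -> blob g D -> blob g' D.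
Proof. by move=> hg b A B hA hB d gA gB; apply: b => //; apply: leq_trans hg _. Qed.

Lemma tiled_card g s D q : tiled g s D q -> #|D| = 2 * (q * s).
Proof.
elim=> [|X Y {}D {}q d1 d2 _ cX cY _ IH]; first by rewrite cards0 muln0.
by rewrite !card_disjointU // cX cY IH mulSn mulnDr mul2n -addnn.
Qed.

Lemma tiled_leq g g' s D q : g <= g' -> tiled g s D q -> tiled g' s D q.
Proof.
move=> hg; elim=> [|X Y {}D {}q d1 d2 j cX cY _ IH]; first exact: tiled0.
by apply: tiledS => //; apply: joined_leq j.
Qed.

Lemma tiledU g s D1 D2 q1 q2 :
  tiled g s D1 q1 -> tiled g s D2 q2 -> [disjoint D1 & D2] ->
  tiled g s (D1 :|: D2) (q1 + q2).
Proof.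
move=> t1 t2; elim: t1 => [|X Y D q d1 d2 j cX cY _ IH]; first by rewrite set0U.
rewrite disjointUl => /andP[d3 d4]; rewrite -setUA addSn; apply: tiledS => //.
  by rewrite disjointUr d2.
exact: IH.
Qed.

Lemma tiled_joined g s k (X Y : {set V}) :
  [disjoint X & Y] -> joined H g X Y -> k * s <= #|X| -> k * s <= #|Y| ->
  exists2 D : {set V}, D \subset X :|: Y & tiled g s D k.
Proof.
elim: k X Y => [|k IH] X Y d j cX cY; first by exists set0; [exact: sub0set|exact: tiled0].
have sX : s <= #|X| by apply: leq_trans cX; rewrite mulSn leq_addr.
have sY : s <= #|Y| by apply: leq_trans cY; rewrite mulSn leq_addr.
pose X1 := trim s X; pose Y1 := trim s Y.
have dX : [disjoint X :\: X1 & Y :\: Y1] := disjoint_sub d (subsetDl _ _) (subsetDl _ _).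
have [||D sD tD] := IH _ _ dX (joined_sub j (subsetDl _ _) (subsetDl _ _)).
- by rewrite cardsD (setIidPr (trim_sub _ _)) trim_card //; move: cX; rewrite mulSn; clear; lia.
- by rewrite cardsD (setIidPr (trim_sub _ _)) trim_card //; move: cY; rewrite mulSn; clear; lia.
have X1X : X1 \subset X := trim_sub _ _; have Y1Y : Y1 \subset Y := trim_sub _ _.
exists (X1 :|: Y1 :|: D).
  rewrite subUset setUSS //=; apply: subset_trans sD _; apply: setUSS; exact: subsetDl.
apply: tiledS => //; rewrite ?trim_card //.
- exact: disjoint_sub d X1X Y1Y.
- apply: disjointWr sD _; rewrite disjointUl !disjointUr.
  rewrite [X in X && _ && _]disjoint_sym disjointDl (disjoint_sub d X1X (subsetDl _ _)).
  rewrite [[disjoint Y1 & _]]disjoint_sym (disjoint_sub d (subsetDl _ _) Y1Y).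
  by rewrite disjoint_sym disjointDl.
- exact: joined_sub j X1X Y1Y.
Qed.

Lemma tiled_blob g s k (D : {set V}) :
  blob g D -> 2 * (k * s) <= #|D| -> exists2 D' : {set V}, D' \subset D & tiled g s D' k.
Proof.
move=> bD cD; pose X := trim (k * s) D.
have cX : #|X| = k * s by apply: trim_card; move: cD; clear; lia.
have XD : X \subset D := trim_sub _ _.
have dX : [disjoint X & D :\: X] by rewrite disjoint_sym disjointDl.
have [||D' sD' tD'] := tiled_joined (s := s) (k := k) dX (blob_joined bD XD (subsetDl _ _) dX).
- by rewrite cX.
- by rewrite cardsD (setIidPr XD) cX; move: cD; clear; lia.
exists D' => //; apply: subset_trans sD' _; by rewrite subUset XD subsetDl.
Qed.

(** Each coarse tile is cut into [m] fine ones; this is needed when one coarse tile becomes the core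
    for the others. *)
Lemma tiled_refine g m s D q :
  tiled g (m * s) D q -> exists2 D' : {set V}, D' \subset D & tiled g s D' (q * m).
Proof.
elim=> [|X Y {}D {}q d1 d2 j cX cY _ [D' sD' tD']].
  by exists set0; [exact: sub0set|exact: tiled0].
have [||D1 sD1 tD1] := tiled_joined (s := s) (k := m) d1 j; rewrite ?cX ?cY //.
exists (D1 :|: D'); first exact: setUSS.
by rewrite mulSn; apply: tiledU => //; apply: disjoint_sub d2 sD1 sD'.
Qed.

Lemma tiled_fun g s D q : tiled g s D q -> exists X Y : nat -> {set V},
  (forall i, i < q -> [/\ [disjoint X i & Y i], joined H g (X i) (Y i), #|X i| = s, #|Y i| = s
     & X i :|: Y i \subset D]) /\
  (forall i j, i < j < q -> [disjoint X i :|: Y i & X j :|: Y j]).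
Proof.
elim=> [|A B {}D {}q d1 d2 j cA cB _ [X [Y [h1 h2]]]].
  by exists (fun=> set0), (fun=> set0); split => // i j; rewrite ltn0 andbF.
exists (fun i => if i is i'.+1 then X i' else A), (fun i => if i is i'.+1 then Y i' else B).
split=> [[|i]|[|i] [|k]] //=.
- by move=> _; split => //; apply: subsetUl.
- rewrite ltnS => /h1[a b c d e]; split => //; apply: subset_trans e (subsetUr _ _).
- by rewrite ltnS => kq; have [_ _ _ _ s1] := h1 _ kq; apply: disjointWr s1 d2.
- by rewrite !ltnS; apply: h2.
Qed.

(** Joined pairs are removed greedily; the process stops because a tile is nonempty. *)
Lemma tiled_exhaust g s (D : {set V}) : 0 < s ->
  exists (A L : {set V}) q, [/\ tiled g s A q, A \subset D, L = D :\: A &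
    forall X Y : {set V}, X \subset L -> Y \subset L -> [disjoint X & Y] ->
      #|X| = s -> #|Y| = s -> ~ joined H g X Y].
Proof.
move=> s0; have [m] := ubnP #|D|; elim: m D => // m IH D hD.
have [[X [Y [XD YD dXY [cX cY] j]]]|no] := classic (exists X Y : {set V},
    [/\ X \subset D, Y \subset D, [disjoint X & Y], #|X| = s /\ #|Y| = s & joined H g X Y]).
  have sXY : X :|: Y \subset D by rewrite subUset XD.
  have [|A [L [q [tA sA eL noL]]]] := IH (D :\: (X :|: Y)).
    rewrite cardsD (setIidPr sXY) card_disjointU // cX cY.
    have : #|X :|: Y| <= #|D| by apply: subset_leq_card.
    by rewrite card_disjointU // cX cY; move: hD s0; clear; lia.
  exists (X :|: Y :|: A), L, q.+1; split => //.
  - apply: tiledS => //; apply: disjointWr sA _; by rewrite disjoint_sym disjointDl.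
  - by rewrite subUset sXY (subset_trans sA) // subsetDl.
  - by rewrite eL setDDl.
exists set0, D, 0; split; rewrite ?sub0set ?setD0 //; first exact: tiled0.
by move=> X Y XD YD d cX cY j; apply: no; exists X, Y.
Qed.

End Tilings.

(** * Reachability and robust access *)

Section Balls.
Variables (V : finType) (H : rel V).
Hypothesis Hsym : symmetric H.
Variable U : {set V}.

(** Iterating from the empty set, [ball F k] consists of the vertices at distance less than [k] from
    [U] once [F] is deleted. The fixed point [component F] is everything reachable from [U]. *)
Definition ball_step (F A : {set V}) := (U :|: nbhd H A) :\: F.
Definition ball (F : {set V}) k := iter k (ball_step F) set0.
Definition component (F : {set V}) := fixset (ball_step F).

Lemma ball_step_mono F : {homo ball_step F : A B / A \subset B}.
Proof. by move=> A B sAB; apply/setSD/setUS/nbhdS. Qed.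

Lemma componentE F : ball_step F (component F) = component F.
Proof. exact/fixsetK/ball_step_mono. Qed.

Lemma component_boundary F u w :
  u \in component F -> w \notin component F -> w \notin F -> ~~ H u w.
Proof.
move=> uC wC wF; apply: contra wC => uw.
by rewrite -componentE in_setD wF in_setU; apply/orP; right; apply/nbhdP; exists u.
Qed.

Lemma component_base F : U :\: F \subset component F.
Proof. by rewrite -componentE; apply/setSD/subsetUl. Qed.

Lemma ball_mono F k : ball F k \subset ball F k.+1.
Proof.
elim: k => [|k IH]; first exact: sub0set.
exact: ball_step_mono.
Qed.

Lemma ball_notin F k : [disjoint ball F k & F].
Proof.
by case: k => [|k]; [rewrite -setI_eq0 set0I|apply: disjointDl].
Qed.

Lemma ball_conn F k y : y \in ball F k ->
  exists v j, [/\ v \in U, j <= k & conn H (ball F k) y v j].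
Proof.
elim: k y => [|k IH] y; first by rewrite inE.
have [yk _|yk] := boolP (y \in ball F k).
  have [v [j [vU jk c]]] := IH y yk; exists v, j; split => //; first exact: ltnW.
  exact: conn_mono (ball_mono _ _) c.
move=> yk1; move: (yk1); rewrite {1}/ball iterS -/(ball F k) in_setD in_setU => /andP[_ /orP[yU|/nbhdP[a aB ay]]].
  by exists y, 0; split => //; apply: conn_refl.
have [v [j [vU jk c]]] := IH a aB; exists v, j.+1; split => //.
apply: conn_mono (conn_cons _ yk c); last by rewrite Hsym.
by rewrite subUset sub1set yk1 ball_mono.
Qed.

(* A minimiser of [#|component F| + rho * #|F|]: removing further vertices
   costs the component at most [rho] vertices for each one removed. *)
Lemma robust_component rho : exists F0 : {set V}, rho * #|F0| <= #|V| /\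
  forall F : {set V}, F0 \subset F -> #|component F0| <= #|component F| + rho * #|F :\: F0|.
Proof.
case: (@arg_minnP _ set0 xpredT (fun F => #|component F| + rho * #|F|)) => // F0 _ hmin.
exists F0; split.
  have := hmin set0 isT; rewrite cards0 muln0 addn0 => /(leq_trans (leq_addl _ _)).
  by move=> h; apply: leq_trans h (max_card _).
move=> F sF; have := hmin F isT.
rewrite cardsD (setIidPr sF) mulnBr.
have : rho * #|F0| <= rho * #|F| by rewrite leq_mul2l subset_leq_card ?orbT.
by clear; lia.
Qed.

(** Otherwise [K] disjoint layers of more than [f] vertices each would overfill [V]. *)
Lemma thin_layer F f K : #|V| < K * f.+1 -> exists2 k, k < K & #|ball F k.+1 :\: ball F k| <= f.
Proof.
move=> hK; have [/existsP[k hk]|/existsPn no] := boolP [exists k : 'I_K, #|ball F k.+1 :\: ball F k| <= f].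
  by exists k.
have big k : k <= K -> k * f.+1 <= #|ball F k|.
  elim: k => [|k IH] kK; first by rewrite mul0n.
  have := no (Ordinal kK); rewrite -ltnNge /= => hk.
  rewrite -(cardsID (ball F k) (ball F k.+1)) (setIidPr (ball_mono F k)).
  by rewrite mulSn addnC leq_add // IH // ltnW.
by have := leq_ltn_trans (max_card (ball F K)) (leq_trans hK (big K (leqnn _))); rewrite ltnn.
Qed.

(** Deleting [F] and a thin layer shrinks the component into a ball of radius below [K]. At most
    [2 * f] vertices are deleted, so robustness bounds the loss by [2 * rho * f < #|X|], and some
    vertex of [X] stays close to [U]. *)
Lemma component_accessible rho f K (F0 X : {set V}) :
  (forall F : {set V}, F0 \subset F -> #|component F0| <= #|component F| + rho * #|F :\: F0|) ->
  X \subset component F0 -> 2 * rho * f < #|X| -> #|V| < K * f.+1 ->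
  accessible H f K X (U :\: F0).
Proof.
move=> rob XC cX hK F cF; pose F1 := F0 :|: F.
have [k kK thin] := thin_layer F1 hK; pose F2 := F1 :|: (ball F1 k.+1 :\: ball F1 k).
have sub2 : component F2 \subset ball F1 k.
  have : ball_step F2 (ball F1 k) \subset ball F1 k.
    apply/subsetP => x; rewrite in_setD => /andP[].
    have -> : (x \notin F2) = (x \notin F1) && (x \notin ball F1 k.+1 :\: ball F1 k).
      by rewrite -negb_or -in_setU.
    move=> /andP[xF1].
    have -> : (x \in U :|: nbhd H (ball F1 k)) = (x \in ball F1 k.+1) by rewrite /ball iterS in_setD xF1.
    by rewrite in_setD => /nandP[/negPn ->//|/negPf ->].
  move=> hs; rewrite /component /fixset; elim: #|V| => [|m IH]; first exact: sub0set.
  rewrite iterS; apply: subset_trans hs; exact: ball_step_mono.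
have [u] : exists u, u \in X :&: ball F1 k.
  apply/set0Pn; rewrite -card_gt0.
  have h1 := rob F2 (subset_trans (subsetUl F0 F) (subsetUl _ _)).
  have h2 : #|F2 :\: F0| <= f + f.
    rewrite /F2 /F1 !setDUl setDv set0U; apply: leq_trans (card_setU_le _ _) _.
    apply: leq_add; first by apply: leq_trans cF; apply/subset_leq_card/subsetDl.
    by apply: leq_trans thin; apply/subset_leq_card/subsetDl.
  have h3 := subset_leq_card sub2.
  have h4 : #|X :\: ball F1 k| <= #|component F0| - #|component F2|.
    have s2 : component F2 \subset component F0.
      have hm m : iter m (ball_step F2) set0 \subset component F0.
        elim: m => [|m IH]; first exact: sub0set.
        rewrite iterS -componentE; apply: subset_trans (ball_step_mono F2 IH) _.
        by apply: setDS; apply: subset_trans (subsetUl F0 F) (subsetUl _ _).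
      exact: hm.
    have -> : #|component F0| - #|component F2| = #|component F0 :\: component F2|.
      by rewrite cardsD (setIidPr s2).
    by apply/subset_leq_card/setDSS.
  have h5 : rho * #|F2 :\: F0| <= rho * (f + f) by rewrite leq_mul2l h2 orbT.
  have h6 : rho * (f + f) = 2 * rho * f by clear; lia.
  have := cardsID (ball F1 k) X; move: h1 h4 h5 cX; rewrite h6.
  by move: (rho * _) => r; clear; lia.
rewrite in_setI => /andP[uX uB]; have [v [j [vU jk c]]] := ball_conn uB.
have dB := ball_notin F1 k.
have vF1 := disjointFr dB (conn_inr c); rewrite in_setU in vF1.
exists u, v, j; split => //.
- by rewrite in_setD vU andbT; case: (v \in F0) vF1.
- exact: leq_trans jk (ltnW kK).
- apply: conn_mono c; rewrite -disjoints_subset; apply: disjointWr dB; exact: subsetUr.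
Qed.

(** From [X :&: P'] one edge leads to [U]; from [X :&: P] two edges do, through a vertex of [P']
    adjacent to [U]. After the deletion one of these parts still has [e] vertices. *)
Lemma bipartite_accessible e f (P P' X : {set V}) :
  [disjoint P & P'] -> joined H e P P' -> U \subset P -> X \subset P :|: P' -> [disjoint X & U] ->
  e + f <= #|U| -> 2 * e + f <= #|P'| -> 2 * (e + f) <= #|X| -> accessible H f 2 X U.
Proof.
move=> dP j UP XP dXU cU cP cX F cF.
have j' := joined_sym Hsym j.
have cUF : e <= #|U :\: F| by apply: leq_trans (card_setD_ge _ _); move: cU cF; clear; lia.
have sUF : U :\: F \subset P by apply: subset_trans (subsetDl _ _) UP.
have nin (A : {set V}) z : z \in A :\: F -> z \in ~: F by rewrite !inE => /andP[].
have [big|small] := leqP e #|(X :&: P') :\: F|.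
  have [|u [v [uX vU uv]]] := j' _ _ _ sUF big cUF.
    by apply: subset_trans (subsetDl _ _) (subsetIr _ _).
  move: (uX); rewrite in_setD in_setI => /and3P[_ uX1 _].
  move: (vU); rewrite in_setD => /andP[_ vU1].
  exists u, v, 1; split => //.
  apply: conn_mono (conn_cons uv _ (conn_refl H (set11 v))).
    by rewrite subUset !sub1set (nin _ _ uX) (nin _ _ vU).
  by rewrite inE; apply: contraTneq uX1 => ->; rewrite (disjointFl dXU vU1).
have big2 : e <= #|(X :&: P) :\: F|.
  have : #|X| <= #|F| + (#|(X :&: P) :\: F| + #|(X :&: P') :\: F|).
    apply: leq_trans (leq_add (leqnn _) (card_setU_le _ _)); apply: leq_trans (card_setU_le _ _).
    apply: subset_leq_card; rewrite -setDUl -setIUr (setIidPl XP).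
    by apply/subsetP => x xX; rewrite in_setU in_setD xX andbT orbN.
  by move: small cX cF; clear; lia.
pose W := (P' :\: F) :&: nbhd H (U :\: F).
have cW : e <= #|W|.
  have sP : P' :\: F \subset P' := subsetDl _ _.
  have := joined_nbhd j sUF sP cUF.
  have := card_setD_ge P' F; have := cardsID (nbhd H (U :\: F)) (P' :\: F).
  by rewrite /W; move: cP cF; clear; lia.
have [||u [w [uX wW uw]]] := j _ _ _ _ big2 cW.
- by apply: subset_trans (subsetDl _ _) (subsetIr _ _).
- by apply: subset_trans (subsetIl _ _) (subsetDl _ _).
move: (wW); rewrite in_setI => /andP[wP /nbhdP[v vU vw]].
have wv : H w v by rewrite Hsym.
move: (uX); rewrite in_setD in_setI => /and3P[_ uX1 uP].
move: (vU); rewrite in_setD => /andP[_ vU1].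
move: (wP); rewrite in_setD => /andP[_ wP1].
have w_v : w \notin [set v].
  by rewrite inE; apply: contraTneq wP1 => ->; rewrite (disjointFr dP (subsetP UP _ vU1)).
have u_wv : u \notin w |: [set v].
  rewrite !inE negb_or; apply/andP; split; first by apply: contraTneq wP1 => <-; rewrite (disjointFr dP uP).
  by apply: contraTneq uX1 => ->; rewrite (disjointFl dXU vU1).
exists u, v, 2; split => //.
apply: conn_mono (conn_cons uw u_wv (conn_cons wv w_v (conn_refl H (set11 v)))).
by rewrite !subUset !sub1set (nin _ _ uX) (nin _ _ wP) (nin _ _ vU).
Qed.

End Balls.

(** * Monochromatic blobs and cores *)

Lemma bush_depth g n : 0 < g -> 2 * g <= n ->
  exists h, [/\ 2 * g <= 2 ^ h, 2 ^ h.-1 <= 2 * g & 2 * h + 5 <= 2 * trunc_log 2 n + 7].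
Proof.
move=> g0 gn; exists (up_log 2 (2 * g)).
have g2 : 1 < 2 * g by move: g0; clear; lia.
have /andP[h1 h2] := up_log_bounds (isT : 1 < 2) g2.
split => //; first exact: ltnW.
have : (up_log 2 (2 * g)).-1 <= trunc_log 2 n.
  by apply: trunc_log_max => //; apply: leq_trans gn; apply: ltnW.
by clear; lia.
Qed.

Section Cases.
Variable V : finType.
Let n := #|V|.
Let tmin := 2 * trunc_log 2 n + 7.

(** The conditions on the scales use a bound [Q] determined by [n] and [s], so they can be fixed
    before the number [q] of tiles is known. *)
Lemma embedding_tiled (H : rel V) g f K N s Q q (D U1 U2 U3 : {set V}) :
  symmetric H -> 0 < g -> [disjoint U1 & U2] -> [disjoint U1 & U3] -> [disjoint U2 & U3] ->
  joined H g U1 U2 -> joined H g U1 U3 -> joined H g U2 U3 ->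
  N <= #|U1| -> N <= #|U2| -> 2 * g <= #|U3| ->
  n <= 2 * (Q * s) -> 100 * g * Q.+1 * K.+1 <= f -> 2 * f <= s -> 8 * s + 8 * Q.+1 * f <= N ->
  tiled H g s D q -> [disjoint D & U1 :|: U2] ->
  (forall X : {set V}, X \subset D -> #|X| = s -> accessible H f K X U1) ->
  forall t, tmin <= t -> t + N <= #|D| -> has_cycle H t.
Proof.
move=> Hs g0 d12 d13 d23 j12 j13 j23 c1 c2 c3 nQ hf hs hN tD dD acc t ht tN.
have gn : 2 * g <= n by apply: leq_trans c3 (max_card _).
have [h [h1 h2 h3]] := bush_depth g0 gn.
have cD := tiled_card tD.
have s0 : 0 < s by move: g0 hf hs; clear; nia.
have qQ : q <= Q.
  have := leq_trans (max_card [in D]) nQ; rewrite cD.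
  by rewrite leq_mul2l /= leq_mul2r => /orP[/eqP s00|//]; move: s0; rewrite s00.
have [X [Y [hXY hd]]] := tiled_fun tD.
apply: (@embedding V H Hs g h f K N s q X Y U1 U2 U3) => //.
- by move=> i iq; have [a b c d e] := hXY i iq; split => //; apply: disjoint_sub dD e (subxx _).
- move=> i iq; have [_ _ cX _ e] := hXY i iq; apply: acc => //.
  exact: subset_trans (subsetUl _ _) e.
- apply: leq_trans hf; rewrite leq_mul2r orbC leq_mul2l ltnS qQ !orbT //.
- apply: leq_trans hN; rewrite leq_add2l leq_mul2r leq_mul2l ltnS qQ !orbT //.
- exact: leq_trans h3 ht.
- by rewrite -cD.
Qed.

Lemma three_parts (D : {set V}) N : 3 * N <= #|D| -> exists U1 U2 U3 : {set V},
  [/\ [/\ U1 \subset D, U2 \subset D & U3 \subset D],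
      [/\ #|U1| = N, #|U2| = N & #|U3| = N] &
      [/\ [disjoint U1 & U2], [disjoint U1 & U3] & [disjoint U2 & U3]]].
Proof.
move=> hD; have [|U1 s1 c1] := @subset_of_card _ D N; first by move: hD; clear; lia.
have e1 : #|D :\: U1| = #|D| - N by rewrite cardsD (setIidPr s1) c1.
have [|U2 s2 c2] := @subset_of_card _ (D :\: U1) N; first by rewrite e1; move: hD; clear; lia.
have e2 : #|(D :\: U1) :\: U2| = #|D| - N - N by rewrite cardsD (setIidPr s2) c2 e1.
have [|U3 s3 c3] := @subset_of_card _ ((D :\: U1) :\: U2) N; first by rewrite e2; move: hD; clear; lia.
exists U1, U2, U3; split; split => //.
- exact: subset_trans s2 (subsetDl _ _).
- by apply: subset_trans s3 _; apply: subset_trans (subsetDl _ _) (subsetDl _ _).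
- by rewrite disjoint_sym; apply: disjointWl s2 (disjointDl _ _).
- by rewrite disjoint_sym; apply: disjointWl (subset_trans s3 (subsetDl _ _)) (disjointDl _ _).
- by rewrite disjoint_sym; apply: disjointWl s3 (disjointDl _ _).
Qed.

(** A blob supplies both a core and tiles covering nearly all the rest, and a single edge connects
    any large part of a tile to the core, so [K] is one. *)
Lemma blob_cycles (H : rel V) g f N s Q (D : {set V}) :
  symmetric H -> 0 < g -> blob H g D -> n <= 2 * (Q * s) -> 200 * g * Q.+1 <= f ->
  2 * f <= s -> 8 * s + 8 * Q.+1 * f <= N ->
  forall t, tmin <= t -> t + 5 * N <= #|D| -> has_cycle H t.
Proof.
move=> Hs g0 bD nQ hf hs hN t ht tN.
have gf : 100 * g <= f by move: hf; clear; nia.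
have N1 : 8 * s + f <= N by move: hN; clear; nia.
have [|U1 [U2 [U3 [[s1 s2 s3] [c1 c2 c3] [d12 d13 d23]]]]] := @three_parts D N.
  by move: tN; clear; lia.
pose D0 := D :\: (U1 :|: U2 :|: U3).
have cD0 : #|D| <= #|D0| + 3 * N.
  have := card_setD_ge D (U1 :|: U2 :|: U3); have := card_setU_le (U1 :|: U2) U3.
  by have := card_setU_le U1 U2; rewrite -/D0 c1 c2 c3; clear; lia.
have sD0 : D0 \subset D := subsetDl _ _.
have bD0 : blob H g D0.
  by move=> A B AD BD; apply: bD; [exact: subset_trans AD sD0|exact: subset_trans BD sD0].
have s0 : 0 < s by move: hs gf g0; clear; lia.
pose k := #|D0| %/ (2 * s).
have k1 : 2 * (k * s) <= #|D0| by rewrite mulnCA; apply: leq_trunc_div.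
have k2 : #|D0| <= 2 * (k * s) + 2 * s.
  have : #|D0| < k.+1 * (2 * s) by rewrite ltn_ceil // muln_gt0.
  by rewrite mulSn mulnCA; clear; lia.
have [D' sD' tD'] := tiled_blob bD0 k1; have cD' := tiled_card tD'.
apply: (embedding_tiled (g := g) (f := f) (K := 1) (N := N) (s := s) (Q := Q) (q := k) (D := D')
  (U1 := U1) (U2 := U2) (U3 := U3)) => //.
- exact: blob_joined bD s1 s2 d12.
- exact: blob_joined bD s1 s3 d13.
- exact: blob_joined bD s2 s3 d23.
- by rewrite c1.
- by rewrite c2.
- by rewrite c3; move: gf N1; clear; lia.
- by move: hf; clear; lia.
- apply: disjointWl sD' _; rewrite /D0.
  by apply: (disjoint_sub (disjointDl D (U1 :|: U2 :|: U3))) (subxx _) (subsetUl _ _).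
- move=> X XD' cX F cF.
  have XD : X \subset D0 := subset_trans XD' sD'.
  have dXU : [disjoint X & U1].
    by apply: (disjoint_sub (disjointDl D (U1 :|: U2 :|: U3)) XD); rewrite -setUA subsetUl.
  have [|||||u [v []]] := bD (X :\: F) (U1 :\: F).
  + apply: subset_trans (subsetDl _ _) (subset_trans XD sD0).
  + exact: subset_trans (subsetDl _ _) s1.
  + by apply: (disjoint_sub dXU); apply: subsetDl.
  + by apply: leq_trans (card_setD_ge _ _); rewrite cX; move: gf hs cF; clear; lia.
  + by apply: leq_trans (card_setD_ge _ _); rewrite c1; move: gf N1 cF hs; clear; lia.
  rewrite !in_setD => /andP[uF uX] /andP[vF vU] uv.
  exists u, v, 1; split => //.
  apply: conn_mono (conn_cons uv _ (conn_refl H (set11 v))).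
    by rewrite subUset !sub1set !in_setC uF.
  by rewrite inE; apply: contraTneq uX => ->; rewrite (disjointFl dXU vU).
- by rewrite cD'; move: tN cD0 k2 N1; clear; lia.
Qed.

(** The only property of the random graph that the colouring argument uses. *)
Definition dense_union (H J : rel V) e :=
  forall A B : {set V}, [disjoint A & B] -> e <= #|A| -> e <= #|B| ->
  exists a b, [/\ a \in A, b \in B & H a b || J a b].

Lemma dense_unionC (H J : rel V) e : dense_union H J e -> dense_union J H e.
Proof.
by move=> G A B d gA gB; have [a [b [? ? h]]] := G A B d gA gB; exists a, b; rewrite orbC.
Qed.

Lemma dense_union_joined (H J : rel V) e (A B : {set V}) :
  dense_union H J e -> [disjoint A & B] ->
  (forall a b, a \in A -> b \in B -> ~~ H a b) -> joined J e A B.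
Proof.
move=> G d no A' B' sA sB gA gB.
have [a [b [aA bB]]] := G A' B' (disjoint_sub d sA sB) gA gB.
rewrite (negPf (no a b _ _)) /=; [by move=> h; exists a, b|exact: (subsetP sA)|exact: (subsetP sB)].
Qed.

Lemma blob_or_hole (H J : rel V) e s (D : {set V}) :
  dense_union H J e ->
  blob H s D \/ exists X Y : {set V}, [/\ X \subset D, Y \subset D, [disjoint X & Y],
     #|X| = s /\ #|Y| = s & joined J e X Y].
Proof.
move=> G; have [h|no] := classic (exists X Y : {set V}, [/\ X \subset D, Y \subset D, [disjoint X & Y],
     #|X| = s /\ #|Y| = s & joined J e X Y]); [by right|left].
move=> A B AD BD d gA gB; apply: NNPP => nE; apply: no.
have sA := trim_sub s A; have sB := trim_sub s B.
exists (trim s A), (trim s B); split.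
- exact: subset_trans sA AD.
- exact: subset_trans sB BD.
- exact: disjoint_sub d sA sB.
- by rewrite !trim_card.
apply: (dense_union_joined G); first exact: disjoint_sub d sA sB.
move=> a b aA bB; apply/negP => ab; apply: nE; exists a, b.
by split => //; [exact: (subsetP sA)|exact: (subsetP sB)].
Qed.

Definition core (H : rel V) N g (U1 U2 U3 : {set V}) :=
  [/\ [/\ [disjoint U1 & U2], [disjoint U1 & U3] & [disjoint U2 & U3]],
      [/\ joined H g U1 U2, joined H g U1 U3 & joined H g U2 U3] &
      [/\ #|U1| = N, #|U2| = N & #|U3| = N]].

Lemma blob_core (H : rel V) N g (D : {set V}) : blob H g D -> 3 * N <= #|D| ->
  exists U1 U2 U3, core H N g U1 U2 U3.
Proof.
move=> bD /three_parts[U1 [U2 [U3 [[s1 s2 s3] cU [d12 d13 d23]]]]].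
exists U1, U2, U3; split => //; split.
- exact: blob_joined bD s1 s2 d12.
- exact: blob_joined bD s1 s3 d13.
- exact: blob_joined bD s2 s3 d23.
Qed.

(** If all of [V] is no [H]-blob, it contains a [J]-joined pair [X], [Y]. If [X] is no [H]-blob
    either, a second [J]-joined pair inside [X] forms a [J]-core together with [Y]. *)
Lemma core_exists (H J : rel V) e N0 N1 N2 :
  symmetric H -> symmetric J -> dense_union H J e -> 3 * N0 <= n -> N2 <= N1 ->
  [\/ exists U1 U2 U3, core H N0 (3 * N1) U1 U2 U3,
      exists U1 U2 U3, core H N1 (3 * N2) U1 U2 U3 |
      exists U1 U2 U3, core J N2 e U1 U2 U3].
Proof.
move=> Hs Js G n0 n12.
have [b|[X [Y [_ _ dXY [cX cY] jXY]]]] := blob_or_hole (3 * N1) [set: V] G.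
  by apply: Or31; apply: blob_core b _; rewrite cardsT.
have [b|[X1 [X2 [sX1 sX2 dX [cX1 cX2] jX]]]] := blob_or_hole (3 * N2) X G.
  by apply: Or32; apply: (blob_core b); rewrite cX.
apply: Or33; exists (trim N2 X1), (trim N2 X2), (trim N2 Y).
have s1 := subset_trans (trim_sub N2 X1) sX1; have s2 := subset_trans (trim_sub N2 X2) sX2.
split; split; first exact: disjoint_sub dX (trim_sub _ _) (trim_sub _ _).
- exact: disjoint_sub dXY s1 (trim_sub _ _).
- exact: disjoint_sub dXY s2 (trim_sub _ _).
- exact: joined_sub jX (trim_sub _ _) (trim_sub _ _).
- exact: joined_sub jXY s1 (trim_sub _ _).
- exact: joined_sub jXY s2 (trim_sub _ _).
- by rewrite trim_card // cX1 leq_pmull.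
- by rewrite trim_card // cX2 leq_pmull.
- by rewrite trim_card // cY; move: n12; clear; lia.
Qed.

End Cases.

(** * From a core to all cycles of one colour *)

Section FromCore.
Variables (V : finType) (H J : rel V).
Let n := #|V|.
Let tmin := 2 * trunc_log 2 n + 7.
Hypotheses (Hs : symmetric H) (Js : symmetric J).
Variables (e g N rho K eta sM fM NM QM sb QB fa sR fR QR : nat).
(* [eta] bounds the total loss.  [s*] are tile sizes, [f*] numbers of vertices
   that may be deleted, [Q*] bounds on the number of tiles; the suffix [R]
   refers to the [H]-tiling of the component, [b], [B], [a] to the [J]-tilings,
   [M] to the two cases of a large blob. *)
Hypothesis G : dense_union H J e.
Hypotheses (e0 : 0 < e) (eg : e <= g) (eR : e <= sR).
Hypotheses (hrho : n <= rho * N) (hN : 7 * N <= eta) (heta : 100 * eta <= n).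
Hypotheses (nM : n <= 2 * (QM * sM)) (gM : 200 * (16 * sb) * QM.+1 <= fM) (fsM : 2 * fM <= sM)
  (sNM : 8 * sM + 8 * QM.+1 * fM <= NM) (NMeta : 8 * NM <= eta).
Hypotheses (nB : n <= 2 * (QB * sb)) (sNB : 8 * (16 * sb) + 8 * QB.+1 * fa <= NM)
  (gB : 300 * sR * QB.+1 <= fa) (fsB : 2 * fa <= sb).
Hypotheses (nR : n <= 2 * (QR * sR)) (gR : 100 * g * QR.+1 * K.+1 <= fR) (fsR : 2 * fR <= sR)
  (sNR : 8 * sR + 8 * QR.+1 * fR <= N) (rhoR : 2 * rho * fR < sR) (KR : n < K * fR.+1).
Hypotheses (sNb : QB.+1 * fR <= sb) (gb : 300 * e * QB.+1 <= fR) (fN : fR + 2 * e <= N)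
  (fsb : 2 * (fR + e) <= sb).

Lemma core_cycles (U1 U2 U3 : {set V}) : core H (2 * N) g U1 U2 U3 ->
  (forall t, tmin <= t -> 2 * t + 32 * eta <= n -> has_cycle H t) \/
  (forall t, tmin <= t -> 2 * t + 32 * eta <= n -> has_cycle J t).
Proof.
move=> [[d12 d13 d23] [j12 j13 j23] [c1 c2 c3]].
have N0 : 0 < N by move: fN e0; clear; lia.
have n0 : 0 < n by move: heta hN N0; clear; lia.
have eta0 : 0 < eta by move: hN N0; clear; lia.
have rho0 : 0 < rho by move: hrho n0; case: (rho) => //; rewrite mul0n leqn0 => /eqP ->.
have sR0 : 0 < sR by move: eR e0; clear; lia.
have sb0 : 0 < 16 * sb by move: fsb e0; clear; lia.
have [F0 [cF0 rob]] := robust_component H U1 rho.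
(* The core sets have [2 * N] vertices so that [N] of them survive this deletion. *)
have {}cF0 : #|F0| <= N by rewrite -(leq_pmul2l rho0); apply: leq_trans hrho.
set R := component H U1 F0 in rob.
have big (U : {set V}) : #|U| = 2 * N -> N <= #|U :\: F0|.
  by move=> cU; apply: leq_trans (card_setD_ge _ _); rewrite cU; move: cF0; clear; lia.
pose U := U1 :|: U2 :|: U3.
have cU : #|U| <= 6 * N.
  have := card_setU_le (U1 :|: U2) U3; have := card_setU_le U1 U2.
  by rewrite -/U c1 c2 c3; clear; lia.
pose B := ~: (R :|: F0).
have [A [L [qA [tA AR eL noL]]]] := tiled_exhaust H e (R :\: U) sR0.
(* The side [16 * sb] is chosen so that one such tile can later serve as core for tiles of side
   [sb]. *)
have [B' [M [qB [tB B'B eM noM]]]] := tiled_exhaust J e B sb0.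
have blobL : blob J sR L.
  have [//|[X [Y [XL YL d [cX cY] j]]]] := blob_or_hole sR L (dense_unionC G).
  by case: (noL X Y).
have blobM : blob H (16 * sb) M.
  have [//|[X [Y [XM YM d [cX cY] j]]]] := blob_or_hole (16 * sb) M G.
  by case: (noM X Y).
have sAR : A \subset R by apply: subset_trans AR (subsetDl _ _).
have sLR : L \subset R by rewrite eL; apply: subset_trans (subsetDl _ _) (subsetDl _ _).
have sMB : M \subset B by rewrite eM subsetDl.
have dAL : [disjoint A & L] by rewrite eL disjoint_sym disjointDl.
have dB'M : [disjoint B' & M] by rewrite eM disjoint_sym disjointDl.
have dRB : [disjoint R & B] by rewrite disjoints_subset /B setCK subsetUl.
have dAU : [disjoint A & U] by apply: disjointWl AR (disjointDl _ _).
have dLU : [disjoint L & U].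
  by rewrite eL; apply: disjointWl (subsetDl _ _) (disjointDl _ _).
have jRB : joined J e R B.
  apply: (dense_union_joined G dRB) => a b aR; rewrite in_setC in_setU negb_or => /andP[bR bF].
  exact: component_boundary aR bR bF.
have VR : U1 :\: F0 \subset R := component_base H U1 F0.
have cover : n <= 7 * N + #|A| + #|L| + #|B'| + #|M|.
  have h1 : #|R :\: U| = #|A| + #|L|.
    by rewrite eL -(cardsID A (R :\: U)) (setIidPr AR).
  have h2 : #|B| = #|B'| + #|M| by rewrite eM -(cardsID B' B) (setIidPr B'B).
  have h3 : n = #|R :|: F0| + #|B| by rewrite /n -(cardsC (R :|: F0)).
  have h4 := card_setU_le R F0; have h5 := card_setD_ge R U.
  by move: h1 h2 h3 h4 h5 cU cF0; clear; lia.
have [caseI|notI] := leqP n (2 * #|A| + 30 * eta).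
  left=> t t1 t2; have sV : (U1 :\: F0) :|: (U2 :\: F0) \subset U.
    by rewrite -setDUl; apply: subset_trans (subsetDl _ _) (subsetUl _ _).
  apply: (embedding_tiled (g := g) (f := fR) (K := K) (N := N) (s := sR) (Q := QR) (q := qA) (D := A)
    (U1 := U1 :\: F0) (U2 := U2 :\: F0) (U3 := U3 :\: F0)) => //.
  - exact: leq_trans eg.
  - exact: disjoint_sub d12 (subsetDl _ _) (subsetDl _ _).
  - exact: disjoint_sub d13 (subsetDl _ _) (subsetDl _ _).
  - exact: disjoint_sub d23 (subsetDl _ _) (subsetDl _ _).
  - exact: joined_sub j12 (subsetDl _ _) (subsetDl _ _).
  - exact: joined_sub j13 (subsetDl _ _) (subsetDl _ _).
  - exact: joined_sub j23 (subsetDl _ _) (subsetDl _ _).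
  - exact: big.
  - exact: big.
  - apply: leq_trans (big U3 c3); apply: leq_trans sNR.
    have : g <= fR by apply: leq_trans gR; clear; nia.
    by move: fsR; clear; lia.
  - exact: tiled_leq eg tA.
  - exact: disjointWr sV dAU.
  - move=> X XA cX; apply: component_accessible rob _ _ KR => //.
      exact: subset_trans XA sAR.
    by rewrite cX.
  - by move: t2 caseI hN eta0; clear; lia.
have blob_case (Q : rel V) lv (D : {set V}) : symmetric Q -> 0 < lv -> blob Q lv D -> lv <= 16 * sb ->
    n <= 2 * #|D| + 28 * eta -> forall t, tmin <= t -> 2 * t + 32 * eta <= n -> has_cycle Q t.
  move=> Qs lv0 bD lvs cD t t1 t2.
  apply: (blob_cycles (g := 16 * sb) (f := fM) (N := NM) (s := sM) (Q := QM) (D := D)) => //.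
  - exact: blob_leq lvs bD.
  - by move: t2 cD NMeta; clear; lia.
have sRfa : 300 * sR <= fa by apply: leq_trans gB; rewrite leq_pmulr.
have sRb : sR <= 16 * sb by move: sRfa fsB; clear; lia.
have [caseII|notII] := leqP n (2 * #|L| + 28 * eta); first by right; apply: blob_case blobL _ _.
have [caseIII|notIII] := leqP n (2 * #|M| + 28 * eta); first by left; apply: blob_case blobM _ _.
right=> t t1 t2.
have sbeta : 32 * (16 * sb) <= eta by move: sNB NMeta; clear; lia.
(* [A] lies in [R] and [M] in [B], so this pair is [J]-joined and can be cut into [J]-tiles up to
   the size of its smaller side. *)
have am_tiles s : 0 < s -> exists (D : {set V}) q,
    [/\ D \subset A :|: M, tiled J e s D q & 2 * minn #|A| #|M| <= #|D| + 2 * s].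
  move=> s0; pose k := minn #|A| #|M| %/ s.
  have dAM : [disjoint A & M] := disjoint_sub dRB sAR sMB.
  have kmin : k * s <= minn #|A| #|M| := leq_trunc_div _ _.
  have [||D sD tD] := tiled_joined (s := s) (k := k) dAM (joined_sub jRB sAR sMB).
  - exact: leq_trans kmin (geq_minl _ _).
  - exact: leq_trans kmin (geq_minr _ _).
  exists D, k; split => //; rewrite (tiled_card tD).
  have : minn #|A| #|M| < k.+1 * s by rewrite ltn_ceil.
  by rewrite mulSn; clear; lia.
have cBB : #|B'| + #|M| <= #|B|.
  by rewrite eM -(cardsID B' B) (setIidPr B'B).
(* A large [L] contains the [J]-core; otherwise a tile of [B'] will provide it. *)
have [caseA|caseB] := leqP eta #|L|.
  have [|U4 [U5 [U6 [[s4 s5 s6] [c4 c5 c6] [d45 d46 d56]]]]] := @three_parts _ L NM.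
    by move: NMeta caseA; clear; lia.
  pose L0 := L :\: (U4 :|: U5 :|: U6).
  have sL0 : L0 \subset L := subsetDl _ _.
  have cL0 : #|L| <= #|L0| + 3 * NM.
    have := card_setD_ge L (U4 :|: U5 :|: U6); have := card_setU_le (U4 :|: U5) U6.
    by have := card_setU_le U4 U5; rewrite -/L0 c4 c5 c6; clear; lia.
  have bL0 : blob J sR L0.
    by move=> X Y XD YD; apply: blobL; [exact: subset_trans XD sL0|exact: subset_trans YD sL0].
  pose k := #|L0| %/ (2 * (16 * sb)).
  have k1 : 2 * (k * (16 * sb)) <= #|L0| by rewrite mulnCA; apply: leq_trunc_div.
  have k2 : #|L0| <= 2 * (k * (16 * sb)) + 2 * (16 * sb).
    have : #|L0| < k.+1 * (2 * (16 * sb)) by rewrite ltn_ceil // muln_gt0.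
    by rewrite mulSn mulnCA; clear; lia.
  have [L' sL' tL'] := tiled_blob bL0 k1; have cL' := tiled_card tL'.
  have [D [q [sD tD cD]]] := am_tiles _ sb0.
  have L'L := subset_trans sL' sL0.
  have dLB' : [disjoint L' & B'] := disjoint_sub dRB (subset_trans L'L sLR) B'B.
  have dD : [disjoint L' :|: B' & D].
    apply: disjointWr sD _; rewrite disjointUr !disjointUl; apply/andP; split; apply/andP; split.
    - by rewrite disjoint_sym; apply: disjointWr dAL.
    - by rewrite disjoint_sym; apply: disjoint_sub dRB sAR B'B.
    - exact: disjoint_sub dRB (subset_trans L'L sLR) sMB.
    - by [].
  have [qq tAll] : exists qq, tiled J sR (16 * sb) (L' :|: B' :|: D) qq.
    by eexists; apply: tiledU (tiledU tL' (tiled_leq eR tB) dLB') (tiled_leq eR tD) dD.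
  have cAll : #|L' :|: B' :|: D| = #|L'| + #|B'| + #|D| by rewrite !card_disjointU.
  have dAll : [disjoint L' :|: B' :|: D & U4 :|: U5].
    rewrite !disjointUl; apply/andP; split; first apply/andP; first split.
    - apply: (disjoint_sub (disjointDl L (U4 :|: U5 :|: U6)) sL'); exact: subsetUl.
    - rewrite disjoint_sym; apply: (disjoint_sub dRB _ B'B).
      by apply: subset_trans sLR; rewrite subUset s4.
    - apply: disjointWl sD _; rewrite disjointUl; apply/andP; split.
        by apply: disjointWr dAL; rewrite subUset s4.
      rewrite disjoint_sym; apply: (disjoint_sub dRB _ sMB).
      by apply: subset_trans sLR; rewrite subUset s4.
  have feNM : e + fa <= NM by move: sNB sRfa eR fsB; clear; nia.
  apply: (embedding_tiled (g := sR) (f := fa) (K := 2) (N := NM) (s := 16 * sb) (Q := QB)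
    (q := qq) (D := L' :|: B' :|: D) (U1 := U4) (U2 := U5) (U3 := U6)) => //.
  - exact: blob_joined blobL s4 s5 d45.
  - exact: blob_joined blobL s4 s6 d46.
  - exact: blob_joined blobL s5 s6 d56.
  - by rewrite c4.
  - by rewrite c5.
  - by rewrite c6; move: sRfa sNB fsB; clear; nia.
  - by apply: leq_trans nB _; rewrite leq_mul2l /= leq_mul2l leq_pmull ?orbT.
  - by move: gB; clear; lia.
  - by move: fsB; clear; lia.
  - move=> X XD cX; apply: (bipartite_accessible Js (e := e) (P := R) (P' := B)) => //.
    + exact: subset_trans s4 sLR.
    + apply: subset_trans XD _; rewrite !subUset (subset_trans (subset_trans L'L sLR) (subsetUl _ _)).
      rewrite (subset_trans B'B (subsetUr _ _)) /=; apply: subset_trans sD _.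
      by rewrite setUSS.
    + exact: disjoint_sub dAll XD (subsetUl _ _).
    + by rewrite c4.
    + apply: leq_trans _ cBB; move: cover notI notII hN feNM NMeta eta0 eR sRfa sNB; clear.
      by move=> *; nia.
    + by rewrite cX; move: sRfa fsB eR; clear; lia.
  (* The tiles cover about [#|L| + #|B'| + 2 * minn #|A| #|M|]. The larger of [A] and [M] is below
     half of [n], so the other three sets already make up the other half. *)
  - rewrite cAll cL'; move: cover notI notII notIII hN t2 cL0 k2 cD NMeta sbeta; clear.
    by lia.
(* [A] and [M] are each below half of [n] by a margin exceeding the small sets. One tile [(X, Y)] of
   [B'] is set aside and forms a [J]-core with [U1 :\: F0], which lies in [R]. *)
have B'0 : 0 < #|B'| by move: cover notI notIII caseB hN; clear; lia.
case: tB B'B eM dB'M cBB cover B'0 => [|X Y D' q' dXY dD' jXY cX cY tD'] B'B eM dB'M cBB cover B'0.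
  by rewrite cards0 in B'0.
have [D1 sD1 tD1] := tiled_refine tD'.
have cD1 := tiled_card tD1; have cD' := tiled_card tD'.
have sb1 : 0 < sb by move: sb0; clear; lia.
have [D [q [sD tD cD]]] := am_tiles _ sb1.
have XB : X \subset B by apply: subset_trans B'B; rewrite -setUA subsetUl.
have YB : Y \subset B by apply: subset_trans B'B; rewrite setUC setUA subsetUr.
have D1B : D1 \subset B by apply: subset_trans sD1 _; apply: subset_trans (subsetUr _ _) B'B.
move: dB'M; rewrite disjointUl => /andP[dXYM dD'M].
have dAB : [disjoint A & B] := disjointWl sAR dRB.
have dD1D : [disjoint D1 & D].
  apply: disjointWr sD _; rewrite disjointUr disjoint_sym (disjointWr D1B dAB) /=.
  exact: disjointWl sD1 dD'M.
have [qq tAll] : exists qq, tiled J e sb (D1 :|: D) qq.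
  by eexists; apply: tiledU tD1 tD dD1D.
have cAll : #|D1 :|: D| = #|D1| + #|D| by rewrite card_disjointU.
have dAll : [disjoint D1 :|: D & X :|: Y].
  rewrite disjointUl [X in X && _]disjoint_sym (disjointWr sD1 dD') /=.
  apply: disjointWl sD _; rewrite disjointUl [X in _ && X]disjoint_sym dXYM andbT.
  by apply: disjointWr dAB; rewrite subUset XB.
have XU : [disjoint X & U1 :\: F0] by rewrite disjoint_sym; apply: disjoint_sub dRB VR XB.
have YU : [disjoint Y & U1 :\: F0] by rewrite disjoint_sym; apply: disjoint_sub dRB VR YB.
have fNs : e + fR <= 16 * sb by move: fsb; clear; lia.
apply: (embedding_tiled (g := e) (f := fR) (K := 2) (N := 16 * sb) (s := sb) (Q := QB)
    (q := qq) (D := D1 :|: D) (U1 := X) (U2 := Y) (U3 := U1 :\: F0)) => //.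
- exact: joined_sub (joined_sym Js jRB) XB VR.
- exact: joined_sub (joined_sym Js jRB) YB VR.
- by rewrite cX.
- by rewrite cY.
- by apply: leq_trans (big U1 c1); move: fN; clear; lia.
- by move: gb; clear; lia.
- by move: fsb; clear; lia.
- by move: sNb; clear; lia.
- move=> Z ZD cZ; apply: (bipartite_accessible Js (e := e) (P := B) (P' := R)) => //.
  + by rewrite disjoint_sym.
  + exact: joined_sym.
  + apply: subset_trans ZD _; rewrite subUset (subset_trans D1B (subsetUl _ _)) /=.
    by apply: subset_trans sD _; rewrite setUC setUSS.
  + exact: disjoint_sub dAll ZD (subsetUl _ _).
  + by rewrite cX.
  + apply: leq_trans (subset_leq_card VR); apply: leq_trans (big U1 c1).
    by move: fN; clear; lia.
  + by rewrite cZ; move: fsb; clear; lia.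
- have cXYD : #|X :|: Y :|: D'| = 16 * sb + 16 * sb + 2 * (q' * (16 * sb)).
    by rewrite !card_disjointU // cX cY cD'.
  move: cover notI notIII caseB hN t2 cD sbeta eta0; rewrite cAll cXYD cD1; clear.
  by lia.
Qed.

End FromCore.

(** * Choice of the scales *)

(** Every scale has the form [n %/ r]; this reduces comparisons of scales to comparisons of constant
    ratios. *)
Lemma div_scale m r r' n : 0 < r -> m * r <= r' -> m * (n %/ r') <= n %/ r.
Proof.
move=> r0 h; rewrite leq_divRL // mulnAC.
by apply: leq_trans (leq_trunc_div n r'); rewrite mulnC leq_mul2l h orbT.
Qed.

Lemma div_cover n r : 0 < r -> r <= n -> n <= 2 * (r * (n %/ r)).
Proof.
move=> r0 rn; have h1 : 0 < n %/ r by rewrite divn_gt0.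
have : n < (n %/ r).+1 * r by rewrite ltn_ceil.
have : r <= r * (n %/ r) by rewrite leq_pmulr.
by rewrite mulSn [X in _ < _ + X]mulnC; clear; lia.
Qed.

(** For a core of scale [n %/ rN], these are the ratios of the tile size [sR], of the deletion bound
    [fR] and of the largest admissible level of joinedness [g]. *)
Definition tile_ratio rN := 32 * rN.
Definition slack_ratio rN := 128 * (tile_ratio rN).+1 * (tile_ratio rN).+1.
Definition hole_ratio rN := 100 * (tile_ratio rN).+1 * (slack_ratio rN).+1 * slack_ratio rN.

Section Scales.
Variables (V : finType).
Let n := #|V|.
Variables r0 : nat.
Hypothesis r0_ge : 100 <= r0.
Let r1 := 8 * r0.
Let r2 := 16 * r1.
Let r3 := 16 * r2.+1 * r1.
Let r4 := 3200 * r2.+1 * r3.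
Let r5 := 16 * r4.+1 * r4.
Definition base_ratio := 300 * r4.+1 * r5.

Lemma core_cycles_scaled (H J : rel V) e g rN (U1 U2 U3 : {set V}) :
  symmetric H -> symmetric J -> dense_union H J e -> base_ratio <= rN -> hole_ratio rN <= n ->
  0 < e -> e <= g -> g <= n %/ hole_ratio rN ->
  core H (2 * (n %/ rN)) g U1 U2 U3 ->
  (forall t, 2 * trunc_log 2 n + 7 <= t -> 2 * t + 32 * (n %/ r0) <= n -> has_cycle H t) \/
  (forall t, 2 * trunc_log 2 n + 7 <= t -> 2 * t + 32 * (n %/ r0) <= n -> has_cycle J t).
Proof.
move=> Hs Js G bN gn e0 eg gN cr.
have p0 : 0 < r0 by apply: leq_trans r0_ge.
have p1 : 0 < r1 by rewrite muln_gt0.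
have p2 : 0 < r2 by rewrite muln_gt0.
have p3 : 0 < r3 by rewrite !muln_gt0.
have p4 : 0 < r4 by rewrite !muln_gt0.
have p5 : 0 < r5 by rewrite !muln_gt0.
have l01 : 8 * r0 <= r1 by [].
have l12 : 16 * r1 <= r2 by [].
have l23 : 16 * r2.+1 <= r3 by apply: leq_pmulr.
have l34 : 3200 * r2.+1 * r3 <= r4 by [].
have l34' : 3200 * r3 <= r4 by rewrite leq_mul2r leq_pmulr ?orbT.
have l13 : 16 * r2.+1 * r1 <= r3 by [].
have l13' : 16 * r1 <= r3 by rewrite leq_mul2r leq_pmulr ?orbT.
have l45 : 16 * r4.+1 * r4 <= r5 by [].
have l45' : 16 * r4.+1 <= r5 by apply: leq_pmulr.
have l45'' : 16 * r4 <= r5 by rewrite leq_mul2r leq_pmulr ?orbT.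
have l5N : 300 * r4.+1 * r5 <= rN by [].
have l5N' : 300 * r5 <= rN by apply: leq_trans l5N; rewrite leq_mul2r leq_pmulr ?orbT.
have lNs : tile_ratio rN = 32 * rN by [].
have lsf : 128 * (tile_ratio rN).+1 * (tile_ratio rN).+1 <= slack_ratio rN by [].
have lsf' : 128 * (tile_ratio rN).+1 <= slack_ratio rN by apply: leq_pmulr.
have lfg : 100 * (tile_ratio rN).+1 * (slack_ratio rN).+1 * slack_ratio rN <= hole_ratio rN by [].
have pN : 0 < rN by move: l5N' p5; clear; lia.
have ps : 0 < tile_ratio rN by move: lNs pN; clear; lia.
have pf : 0 < slack_ratio rN by move: lsf'; clear; lia.
have pfg : 100 * (tile_ratio rN).+1 * slack_ratio rN <= hole_ratio rN.
  by apply: leq_trans lfg; rewrite leq_mul2r leq_pmulr ?orbT.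
have pfg' : slack_ratio rN <= hole_ratio rN.
  by apply: leq_trans pfg; rewrite leq_pmull // muln_gt0.
(* From here on the ratios are opaque and only the listed inequalities are used, which keeps the
   arithmetic within reach of [lia]. *)
move: (tile_ratio rN) (slack_ratio rN) (hole_ratio rN) lNs lsf lsf' lfg ps pf pfg pfg' gn gN => s f gg lNs lsf lsf' lfg ps pf pfg pfg' gn gN.
clearbody r1 r2 r3 r4 r5.
have lsN : s.+1 * rN <= s.+1 * s.+1 by rewrite leq_mul2l; move: lNs; clear; lia.
have lss : rN * s <= s.+1 * s.+1 by apply: leq_mul; move: lNs; clear; lia.
have l44 : r4.+1 * r4 <= s.+1 * s.+1 by apply: leq_mul; move: lNs l5N' l45'; clear; lia.
have egf : e <= n %/ f.
  apply: leq_trans eg (leq_trans gN _); rewrite -[X in X <= _]mul1n; apply: div_scale => //.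
  by rewrite mul1n.
apply: (core_cycles Hs Js (e := e) (g := g) (N := n %/ rN) (rho := 2 * rN) (K := f) (eta := n %/ r0)
  (sM := n %/ r2) (fM := n %/ r3) (NM := n %/ r1) (QM := r2) (sb := n %/ r4) (QB := r4)
  (fa := n %/ r5) (sR := n %/ s) (fR := n %/ f) (QR := s)) cr => //.
- apply: leq_trans egf _; rewrite -[X in X <= _]mul1n; apply: div_scale => //.
  by move: lsf'; clear; lia.
- rewrite -mulnA; apply: div_cover => //.
  by apply: leq_trans gn; apply: leq_trans pfg'; move: lsf' lNs; clear; lia.
- apply: div_scale => //; move: l5N' l45' l34' l23 l12 l01; clear; lia.
- by apply: leq_trans (leq_trunc_div n r0); rewrite mulnC leq_mul2l r0_ge orbT.
- by apply: div_cover => //; apply: leq_trans gn; apply: leq_trans pfg'; move: lsf' lNs l5N' l45' l34' l23 l12 l01; clear; lia.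
- by have := @div_scale (3200 * r2.+1) r3 r4 n p3 l34; move: (n %/ r4) (n %/ r3) => x y; clear; lia.
- by apply: div_scale => //; move: l23; clear; lia.
- by have := @div_scale 16 r1 r2 n p1 l12; have := @div_scale (16 * r2.+1) r1 r3 n p1 l13; move: (n %/ r1) (n %/ r2) (n %/ r3) => x y z; clear; lia.
- exact: div_scale.
- by apply: div_cover => //; apply: leq_trans gn; apply: leq_trans pfg'; move: lsf' lNs l5N' l45' l34' l23 l12 l01; clear; lia.
- have := @div_scale (16 * r4.+1) r4 r5 n p4 l45.
  have : 256 * (n %/ r4) <= n %/ r1 by apply: div_scale => //; move: l34' l13'; clear; lia.
  by move: (n %/ r1) (n %/ r4) (n %/ r5) => x y z; clear; lia.
- have h : 300 * r4.+1 * r5 <= s by apply: leq_trans l5N _; rewrite lNs leq_pmull.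
  by rewrite -mulnA [_ * r4.+1]mulnC mulnA; apply: div_scale.
- by apply: div_scale => //; move: l45''; clear; lia.
- by apply: div_cover => //; apply: leq_trans gn; apply: leq_trans pfg'; move: lsf'; clear; lia.
- have := @div_scale (100 * s.+1 * f.+1) f gg n pf lfg.
  apply: leq_trans; rewrite -!mulnA leq_mul2l /= mulnC -!mulnA leq_mul2l /= mulnC mulnC.
  by rewrite leq_mul2l gN orbT.
- by apply: div_scale => //; move: lsf'; clear; lia.
- have : 32 * (n %/ s) <= n %/ rN by apply: div_scale => //; rewrite lNs.
  have : 16 * s.+1 * (n %/ f) <= n %/ rN.
    by apply: div_scale => //; move: lsN lsf; rewrite -!mulnA; clear; lia.
  by move: (n %/ f) (n %/ s) (n %/ rN) => x y z; clear; lia.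
- have sR0 : 0 < n %/ s.
    by rewrite divn_gt0 //; apply: leq_trans gn; apply: leq_trans pfg'; move: lsf'; clear; lia.
  have : 8 * rN * (n %/ f) <= n %/ s.
    by apply: div_scale => //; move: lss lsf; rewrite -!mulnA; clear; lia.
  by move: sR0; move: (n %/ f) (n %/ s) => x y; clear; lia.
- by rewrite mulnC ltn_ceil.
- by apply: div_scale => //; move: l44 lsf; clear; lia.
- have h : 300 * r4.+1 * f <= gg.
    apply: leq_trans pfg; rewrite leq_mul2r; apply/orP; right.
    by move: lNs l5N' l45'; clear; lia.
  have := @div_scale (300 * r4.+1) f gg n pf h.
  have : 300 * r4.+1 * e <= 300 * r4.+1 * (n %/ gg) by rewrite leq_mul2l (leq_trans eg gN) orbT.
  by move: (n %/ gg) (n %/ f) => x y; clear; lia.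
- have : 3 * (n %/ f) <= n %/ rN by apply: div_scale => //; move: lsf' lNs; clear; lia.
  by move: egf; move: (n %/ f) (n %/ rN) => x y; clear; lia.
- have : 4 * (n %/ f) <= n %/ r4 by apply: div_scale => //; move: lsf' lNs l5N' l45'; clear; lia.
  by move: egf; move: (n %/ f) (n %/ r4) => x y; clear; lia.
Qed.

(** A core is joined at level [3 * N1] with [N1 = 2 * (n %/ second_ratio)]; the factor six brings
    this below [n %/ hole_ratio base_ratio]. The next ratio follows the same pattern. *)
Definition second_ratio := 6 * hole_ratio base_ratio.
Definition third_ratio := 6 * hole_ratio second_ratio.
Definition threshold := hole_ratio third_ratio.

Lemma two_color_cycles (H J : rel V) :
  symmetric H -> symmetric J -> threshold <= n -> dense_union H J (n %/ threshold) ->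
  (forall t, 2 * trunc_log 2 n + 7 <= t -> 2 * t + 32 * (n %/ r0) <= n -> has_cycle H t) \/
  (forall t, 2 * trunc_log 2 n + 7 <= t -> 2 * t + 32 * (n %/ r0) <= n -> has_cycle J t).
Proof.
have le_rg x : x <= hole_ratio x.
  have h : x <= slack_ratio x by apply: (@leq_trans (128 * (32 * x).+1)); [clear; lia|exact: leq_pmulr].
  by apply: leq_trans h _; rewrite /hole_ratio leq_pmull.
move=> Hs Js Zn G; set e := n %/ threshold in G.
have p0 : 6 <= base_ratio.
  have : 0 < r5 by rewrite !muln_gt0 andbT /=; move: r0_ge; clear; lia.
  move=> p5; apply: (@leq_trans 300) => //; by rewrite /base_ratio -mulnA leq_pmulr // muln_gt0.
have b0 := le_rg base_ratio; have b1 : 6 * hole_ratio base_ratio <= second_ratio by [].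
have b1' := le_rg second_ratio; have b2 : 6 * hole_ratio second_ratio <= third_ratio by [].
have b2' := le_rg third_ratio.
have b3 : hole_ratio third_ratio <= threshold by [].
move: p0 b0 b1 b1' b2 b2' b3 Zn @e G.
move: second_ratio third_ratio threshold => s1 s2 Z p0 b0 b1 b1' b2 b2' b3 Zn e G.
have Z0 : 0 < Z by move: p0 b0 b1 b1' b2 b2' b3; clear; lia.
have e0 : 0 < e by rewrite divn_gt0.
have le_e r : 0 < r -> r <= Z -> e <= n %/ r.
  by move=> rr rZ; rewrite -[e]mul1n; apply: div_scale => //; rewrite mul1n.
have lvl r : 0 < r -> r <= Z -> e <= 3 * (2 * (n %/ r)).
  by move=> rr rZ; apply: leq_trans (le_e r rr rZ) _; rewrite mulnA leq_pmull.
have [||[U1 [U2 [U3 cr]]]|[U1 [U2 [U3 cr]]]|[U1 [U2 [U3 cr]]]] :=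
    core_exists (N0 := 2 * (n %/ base_ratio)) (N1 := 2 * (n %/ s1)) (N2 := 2 * (n %/ s2)) Hs Js G.
- by rewrite mulnA -[X in _ <= X]divn1; apply: div_scale; rewrite // muln1.
- rewrite leq_mul2l /=; rewrite -[X in X <= _]mul1n; apply: div_scale; move: p0 b0 b1 b1' b2; clear; lia.
- apply: (core_cycles_scaled (rN := base_ratio) Hs Js G) cr => //.
  + by move: Zn b1 b1' b2 b2' b3; clear; lia.
  + by apply: lvl; move: p0 b0 b1 b1' b2 b2' b3; clear; lia.
  + by rewrite mulnA; apply: div_scale => //; move: p0 b0; clear; lia.
- apply: (core_cycles_scaled (rN := s1) Hs Js G) cr => //.
  + by move: b0 b1; clear; lia.
  + by move: Zn b2 b2' b3; clear; lia.
  + by apply: lvl; move: p0 b0 b1 b1' b2 b2' b3; clear; lia.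
  + by rewrite mulnA; apply: div_scale => //; move: p0 b0 b1 b1'; clear; lia.
- have := core_cycles_scaled (rN := s2) Js Hs (dense_unionC G) _ _ e0 (leqnn e) _ cr.
  case=> [||| |]; try by [left|right].
  + by move: b0 b1 b1' b2; clear; lia.
  + exact: leq_trans b3 Zn.
  + by apply: le_e => //; move: p0 b0 b1 b1' b2 b2'; clear; lia.
Qed.

End Scales.

Lemma threshold_gt0 r0 : 0 < threshold r0.
Proof. by rewrite /threshold /hole_ratio /slack_ratio !muln_gt0. Qed.

Require Import Defs.
From HB Require Import structures.
From mathcomp Require Import all_boot all_order all_algebra lra.
From mathcomp Require Import all_classical all_reals all_analysis.

Import Order.TTheory GRing.Theory Num.Theory.
Import numFieldNormedType.Exports.
Local Open Scope ring_scope.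

(** * The random graph *)

Lemma has_cycle_copy (G : sgraph) (t : nat) :
  (0 < t)%N -> has_cycle (@adj G) t -> has_copy G (cycle_graph t).
Proof.
move=> t0 [[|x0 p] [us cs sz]]; first by rewrite -sz in t0.
have nextP i : (i < t)%N -> adj (nth x0 (x0 :: p) i) (nth x0 (x0 :: p) (i.+1 %% t)%N).
  move=> it; have := cs; rewrite /= => /(pathP x0) /(_ i).
  rewrite size_rcons -[(size p).+1]/(size (x0 :: p)) sz => /(_ it).
  rewrite -rcons_cons nth_rcons sz it.
  have [lt|ge] := ltnP i.+1 t; first by rewrite modn_small // nth_rcons; move: lt; rewrite -sz /= ltnS => ->.
  have -> : i.+1 = t by apply/eqP; rewrite eqn_leq it ge.
  have -> : i = size p by move: ge it; rewrite -sz /=; lia.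
  by rewrite modnn nth_rcons ltnn eqxx.
exists (fun i : 'I_t => nth x0 (x0 :: p) i); split.
  move=> i j /eqP; rewrite nth_uniq ?sz // => /eqP; exact: val_inj.
move=> i j /= /andP[_ /orP[]] /eqP ->; first exact: (nextP i (ltn_ord i)).
by rewrite adj_sym; exact: (nextP j (ltn_ord j)).
Qed.

(** Sets of size exactly [e] have exactly [e * e] crossing pairs, and larger sets can be trimmed to
    this size. *)
Definition joined_pairs (n e : nat) (E : {set {set 'I_n}}) :=
  forall A B : {set 'I_n}, [disjoint A & B] -> #|A| = e -> #|B| = e ->
  exists a b, [/\ a \in A, b \in B & [set a; b]%SET \in E].

Definition crossing_pairs (n : nat) (A B : {set 'I_n}) : {set {set 'I_n}} :=
  [set [set a; b]%SET | a in A, b in B]%SET.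

Lemma crossing_pairs_sub n (A B : {set 'I_n}) :
  [disjoint A & B] -> crossing_pairs A B \subset vertex_pairs n.
Proof.
move=> d; apply/fintype.subsetP => x /imset2P[a b aA bB ->]; rewrite inE cards2.
by case: (eqVneq a b) aA => [->|] //; rewrite (disjointFl d bB).
Qed.

Lemma card_crossing_pairs n (A B : {set 'I_n}) :
  [disjoint A & B] -> #|crossing_pairs A B| = (#|A| * #|B|)%N.
Proof.
move=> d; rewrite -cardsX /crossing_pairs curry_imset2X card_in_imset //.
move=> [a b] [a' b'] /setXP[/= aA bB] /setXP[/= a'A b'B] h.
have : a \in [set a'; b']%SET by rewrite -h !inE eqxx.
have : b \in [set a'; b']%SET by rewrite -h !inE eqxx orbT.
rewrite !inE => /orP[/eqP e1|/eqP ->] /orP[/eqP ->|/eqP e2] //.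
- by move: (disjointFr d a'A); rewrite -e1 bB.
- by move: (disjointFr d a'A); rewrite -e1 bB.
- by move: (disjointFl d b'B); rewrite -e2 aA.
Qed.

Section Probability.
Variables (R : realType) (n : nat) (p : R).
Hypotheses (p0 : 0 <= p) (p1 : p <= 1).

Let wt (E : {set {set 'I_n}}) : R :=
  \prod_(e in vertex_pairs n) (if e \in E then p else 1 - p).

Lemma wt_ge0 E : 0 <= wt E.
Proof. by apply: prodr_ge0 => e _; case: ifP => _ //; rewrite subr_ge0. Qed.

(** Expanding the product of [F e + G e] over all sets [e] gives the sum over all edge sets; [F]
    vanishes on [K] and off the vertex pairs, which kills every other term. *)
Lemma sum_wt_avoid (K : {set {set 'I_n}}) : K \subset vertex_pairs n ->
  \sum_(E : {set {set 'I_n}} | (E \subset vertex_pairs n) && [disjoint E & K]) wt E =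
    (1 - p) ^+ #|K|.
Proof.
move=> /fintype.subsetP KP.
pose F (e : {set 'I_n}) := if (e \in vertex_pairs n) && (e \notin K) then p else 0.
pose G (e : {set 'I_n}) := if e \in vertex_pairs n then 1 - p else 1.
have -> : (1 - p) ^+ #|K| = \prod_e (F e + G e).
  rewrite -prodr_const [RHS](bigID [in K]) /= [X in _ = _ * X]big1 ?mulr1.
    by apply: eq_bigr => e eK; rewrite /F /G eK (KP _ eK) add0r.
  move=> e eK; rewrite /F /G eK andbT; case: ifP => _; last by rewrite add0r.
  by rewrite addrC subrK.
rewrite bigA_distr [RHS](bigID (fun E : {set {set 'I_n}} => (E \subset vertex_pairs n) && [disjoint E & K])) /=.
rewrite [X in _ = _ + X]big1 ?addr0; last first.
  move=> E; rewrite negb_and => /orP[/fintype.subsetPn[e eE eP]|].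
    by apply/eqP/prodf_eq0; exists e => //; rewrite eE /F (negPf eP).
  rewrite disjoint_sym => /pred0Pn[e /andP[/= eK eE]].
  by apply/eqP/prodf_eq0; exists e => //; rewrite eE /F eK andbF.
apply: eq_bigr => E /andP[/fintype.subsetP EP dE]; rewrite /wt big_mkcond /=.
apply: eq_bigr => e _; rewrite /F /G; case: (boolP (e \in E)) => eE.
  by rewrite (EP _ eE) (disjointFr dE eE).
by case: ifP.
Qed.

Lemma sum_wt : \sum_(E : {set {set 'I_n}} | E \subset vertex_pairs n) wt E = 1.
Proof.
have := sum_wt_avoid (finset.sub0set _); rewrite cards0 expr0 => <-.
apply: eq_bigl => E; by rewrite -setI_eq0 finset.setI0 eqxx andbT.
Qed.

Lemma gnp_prob_le1 (Q : sgraph -> Prop) : gnp_prob n p Q <= 1.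
Proof.
rewrite -sum_wt /gnp_prob [leRHS](bigID (fun E => `[< Q (graph_of_edges E) >])) /=.
by rewrite lerDl; apply: sumr_ge0 => E _; apply: wt_ge0.
Qed.

(** Union bound over the at most [4 ^ n] pairs of vertex sets, each being left without an edge with
    probability [(1 - p) ^+ (e * e)]. *)
Lemma gnp_prob_joined (e : nat) (Q : sgraph -> Prop) :
  (forall E : {set {set 'I_n}}, joined_pairs e E -> Q (graph_of_edges E)) ->
  1 - 4 ^+ n * (1 - p) ^+ (e * e) <= gnp_prob n p Q.
Proof.
move=> hQ; rewrite lerBlDr -[leLHS]sum_wt [leLHS](bigID (fun E => `[< Q (graph_of_edges E) >])) /=.
rewrite lerD2l.
pose I := ({set 'I_n} * {set 'I_n})%type.
pose ok (AB : I) := [&& [disjoint AB.1 & AB.2], #|AB.1| == e & #|AB.2| == e].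
have -> : 4 ^+ n * (1 - p) ^+ (e * e) = \sum_(AB : I) (1 - p) ^+ (e * e).
  rewrite sumr_const -[RHS]mulr_natl; congr (_ * _).
  have cS : #|{set 'I_n}| = (2 ^ n)%N by rewrite -finset.cardsT -finset.powersetT finset.card_powerset finset.cardsT card_ord.
  by rewrite card_prod cS -expnMn natrX.
apply: (@le_trans _ _ (\sum_(AB : I | ok AB) (1 - p) ^+ (e * e))); last first.
  rewrite [leRHS](bigID ok) /= lerDl; apply: sumr_ge0 => *; apply: exprn_ge0.
  by rewrite subr_ge0.
have -> : \sum_(AB : I | ok AB) (1 - p) ^+ (e * e) =
    \sum_(AB : I | ok AB) \sum_(E : {set {set 'I_n}} | (E \subset vertex_pairs n) &&
      [disjoint E & crossing_pairs AB.1 AB.2]) wt E.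
  apply: eq_bigr => -[A B] /= /and3P[d /eqP cA /eqP cB].
  by rewrite sum_wt_avoid ?crossing_pairs_sub // card_crossing_pairs // cA cB.
(* With the sums exchanged, it suffices that every graph failing [Q] is counted at least once, by a
   pair without crossing edge. *)
rewrite (exchange_big_dep (fun E : {set {set 'I_n}} => E \subset vertex_pairs n)) /=; last first.
  by move=> ? ? _ /andP[].
rewrite [leRHS](bigID (fun E => `[< Q (graph_of_edges E) >])) /=.
apply: ler_wpDl; first by apply: sumr_ge0 => E _; apply: sumr_ge0 => *; apply: wt_ge0.
apply: ler_sum => E /andP[EP /asboolPn nQ].
have [AB [okAB dAB]] : exists AB, ok AB /\ [disjoint E & crossing_pairs AB.1 AB.2].
  apply: contrapT => no; apply: nQ; apply: hQ => A B d cA cB.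
  apply: contrapT => nE; apply: no; exists (A, B); split.
    by rewrite /ok /= d cA cB !eqxx.
  rewrite -setI_eq0; apply/eqP/finset.setP => x; rewrite [RHS]inE; apply/negP.
  rewrite finset.in_setI => /andP[xE /imset2P[a b aA bB xab]].
  by apply: nE; exists a, b; rewrite -xab.
rewrite (bigD1 AB) /=; last by rewrite okAB EP.
by rewrite lerDl; apply: sumr_ge0 => *; apply: wt_ge0.
Qed.

End Probability.

(** * Estimates and limits *)

(** From [e >= n / (2 * Z)] follows [p * e ^ 2 >= 28 / 4 * n = 7 * n], and [4 * expR (- 7) <= 4 / 8]
    because [expR 7 >= 1 + 7]. *)
Lemma failure_bound (R : realType) (n Z e : nat) (p : R) :
  (0 < n)%N -> (n <= 2 * (Z * e))%N -> (28 * Z ^ 2)%:R / n%:R <= p -> p <= 1 ->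
  4 ^+ n * (1 - p) ^+ (e * e) <= 2^-1 ^+ n.
Proof.
move=> n0 nZe hp p1.
have n0' : 0 < n%:R :> R by rewrite ltr0n.
have h7 : 7 * n%:R <= p * (e * e)%:R.
  apply: (@le_trans _ _ ((28 * Z ^ 2)%:R / n%:R * (e * e)%:R)); last by apply: ler_wpM2r.
  rewrite mulrAC ler_pdivlMr // -mulrA -!natrM ler_nat.
  have : (n * n <= 2 * (Z * e) * (2 * (Z * e)))%N by apply: leq_mul.
  by clear; lia.
have h1 : (1 - p) ^+ (e * e) <= expR (- (7 * n%:R)).
  apply: (@le_trans _ _ (expR (- p) ^+ (e * e))).
    apply: lerXn2r; rewrite ?nnegrE ?subr_ge0 ?expR_ge0 //; exact: expR_ge1Dx.
  by rewrite -expRM_natr ler_expR mulNr lerN2.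
have h8 : 8 <= expR (7 : R) by apply: le_trans (expR_ge1Dx _); rewrite -natr1 addrC.
apply: le_trans (ler_wpM2l (exprn_ge0 _ _) h1) _ => //.
rewrite -mulNr expRM_natr -exprMn.
apply: lerXn2r; rewrite ?nnegrE ?mulr_ge0 ?expR_ge0 ?invr_ge0 //.
rewrite expRN ler_pdivrMr ?expR_gt0 // mulrC ler_pdivlMr //.
by rewrite -natrM.
Qed.

(** The origin of the absolute constant [3 / ln 2]: two binary logarithms pay for the two trees, and
    the third is at least [7] because [128 = 2 ^ 7]. *)
Lemma logarithm_bound (R : realType) (n t : nat) :
  (128 <= n)%N -> 3 / ln 2 * ln n%:R <= t%:R :> R -> (2 * trunc_log 2 n + 7 <= t)%N.
Proof.
move=> n128 ht.
have ln2 : 0 < ln (2 : R) by apply: ln_gt0; rewrite ltr1n.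
have n0 : 0 < n%:R :> R by rewrite ltr0n; apply: leq_trans n128.
have pow k : (2 ^ k <= n)%N -> k%:R <= ln n%:R / ln 2 :> R.
  move=> hk; rewrite ler_pdivlMr // mulr_natl -lnXn // ler_ln ?posrE ?exprn_gt0 //.
  by rewrite -natrX ler_nat.
rewrite -(ler_nat R); apply: le_trans ht.
have -> : 3 / ln 2 * ln n%:R = 3 * (ln n%:R / ln 2) :> R by rewrite mulrAC mulrA.
rewrite natrD natrM.
have h1 := pow _ (trunc_logP (isT : (1 < 2)%N) (leq_trans (isT : (0 < 128)%N) n128)).
have h2 := pow 7%N n128.
apply: (@le_trans _ _ (2 * (ln n%:R / ln 2) + ln n%:R / ln 2)).
  by apply: lerD => //; apply: ler_wpM2l.
lra.
Qed.

Lemma joined_pairs_cycles (R : realType) (beta : R) (r0 n : nat) (E : {set {set 'I_n}}) :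
  (100 <= r0)%N -> 16 <= beta * r0%:R -> (128 <= n)%N -> (threshold r0 <= n)%N ->
  joined_pairs (n %/ threshold r0) E ->
  forall c : coloring (graph_of_edges E) 2, exists i : 'I_2, forall t : nat,
    3 / ln 2 * ln n%:R <= t%:R :> R -> t%:R <= (1 / 2 - beta) * n%:R -> has_copy (color_class c i) (cycle_graph t).
Proof.
move=> r100 hb n128 hZ hE c.
pose H (i : 'I_2) : rel 'I_n := @adj (color_class c i).
have Hs i : symmetric (H i) := @adj_sym (color_class c i).
have G : dense_union (H ord0) (H ord_max) (n %/ threshold r0).
  move=> A B d gA gB.
  have [a [b [aA bB ab]]] := hE _ _ (disjoint_sub d (trim_sub _ _) (trim_sub _ _)) (trim_card gA) (trim_card gB).
  have aA' := fintype.subsetP (trim_sub _ _) _ aA; have bB' := fintype.subsetP (trim_sub _ _) _ bB.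
  exists a, b; split => //; rewrite /H /= ab andbT.
  have -> /= : a != b by apply: contraTneq bB' => <-; rewrite (disjointFr d aA').
  by case: (c _) => -[|[|m]] im //=; rewrite -!val_eqE.
(* Since [16 <= beta * r0], the loss [32 * (n %/ r0)] is at most [2 * beta * n]. *)
have fin (i : 'I_2) : (forall t, (2 * trunc_log 2 #|'I_n| + 7 <= t)%N -> (2 * t + 32 * (#|'I_n| %/ r0) <= #|'I_n|)%N -> has_cycle (H i) t) ->
    forall t : nat, 3 / ln 2 * ln n%:R <= t%:R :> R -> t%:R <= (1 / 2 - beta) * n%:R -> has_copy (color_class c i) (cycle_graph t).
  rewrite card_ord => hi t t1 t2.
  have t7 := logarithm_bound n128 t1.
  apply: has_cycle_copy; first by apply: leq_trans t7; rewrite addnS.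
  apply: hi => //; rewrite -(ler_nat R) natrD !natrM.
  have h : r0%:R * (n %/ r0)%:R <= n%:R :> R by rewrite -natrM ler_nat mulnC leq_trunc_div.
  have q0 : 0 <= (n %/ r0)%:R :> R by [].
  have r0p : 0 < r0%:R :> R by rewrite ltr0n; apply: leq_trans r100.
  have beta0 : 0 <= beta by rewrite -(pmulr_lge0 beta r0p); apply: le_trans hb.
  have h3 : 16 * (n %/ r0)%:R <= beta * n%:R.
    by apply: le_trans (ler_wpM2r q0 hb) _; rewrite -mulrA; apply: ler_wpM2l h.
  move: t2 h3; move: (n %/ r0)%:R => x t2 h3; lra.
have := two_color_cycles (V := 'I_n) r100 (Hs ord0) (Hs ord_max).
rewrite card_ord => /(_ hZ G) [h|h]; [exists ord0|exists ord_max]; apply: fin; by rewrite card_ord.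
Qed.

(** With [T] the integer part of [l], either [T] or [T.-1] is odd, and [l < T + 1]. *)
Lemma floor_odd_spec (R : realType) (l : R) : 1 <= l ->
  [/\ odd (floor_odd l), (floor_odd l)%:R <= l & l - 2 <= (floor_odd l)%:R].
Proof.
move=> l1; have l0 : 0 <= l by apply: le_trans l1.
set T := Num.truncn l.
have /andP[T1 T2] := truncn_itv l0; rewrite -/T in T1 T2.
have T0 : (0 < T)%N by rewrite truncn_gt0.
have lb (m : nat) : (m <= T)%N -> odd m -> (m <= floor_odd l)%N.
  by move=> mT om; apply: (leq_bigmax_cond (Ordinal (mT : (m < T.+1)%N)) om).
have [i oi ei] : {i : 'I_T.+1 | odd i & floor_odd l = i}.
  have c0 : (0 < #|[pred m : 'I_T.+1 | odd m]|)%N.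
    by apply/card_gt0P; exists (Ordinal (T0 : (1 < T.+1)%N)).
  by have [i oi ei] := eq_bigmax_cond (fun m : 'I_T.+1 => m : nat) c0; exists i.
split; first by rewrite ei.
  by rewrite ei; apply: le_trans T1; rewrite ler_nat -ltnS.
have : (T.-1 <= floor_odd l)%N.
  have [oT|eT] := boolP (odd T); first by apply: leq_trans (leq_pred _) _; apply: lb.
  by apply: lb; [exact: leq_pred|move: eT; rewrite -{1}(prednK T0) /= negbK].
rewrite -(ler_nat R); apply: le_trans.
rewrite lerBlDr; apply: le_trans (ltW T2) _.
by rewrite -natrD ler_nat; lia.
Qed.

Local Open Scope classical_set_scope.

Lemma near_ge (m : nat) : \forall n \near \oo, (m <= n)%N.
Proof. exact: nbhs_infty_ge. Qed.

(** With [q] the square root of [n], [ln n = 2 * ln q <= 2 * q], so the left side is at most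
    [(2 * A + 2) * q], which is at most [c * q ^ 2] once [q >= (2 * A + 2) / c]. *)
Lemma near_log_le (R : realType) (A c : R) : 0 < A -> 0 < c ->
  \forall n \near \oo, A * ln n%:R + 2 <= c * n%:R.
Proof.
move=> A0 c0; pose s : R := (2 * A + 2) / c.
near=> n.
have n1 : 1 <= n%:R :> R by rewrite ler1n; near: n; exact: near_ge.
have n0 : 0 < n%:R :> R by apply: lt_le_trans n1.
have s0 : 0 <= s by rewrite divr_ge0 ?ltW // addr_gt0 ?mulr_gt0.
pose q : R := Num.sqrt n%:R.
have q1 : 1 <= q by rewrite -[leLHS]sqrtr1 ler_wsqrtr.
have q0 : 0 < q by apply: lt_le_trans q1.
have qq : n%:R = q ^+ 2 by rewrite sqr_sqrtr // ltW.
have sq : s <= q.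
  have : s ^+ 2 <= q ^+ 2.
    rewrite -qq; apply: (@le_trans _ _ (Num.truncn (s ^+ 2)).+1%:R); first by apply/ltW/truncnS_gt.
    by rewrite ler_nat; near: n; exact: near_ge.
  by rewrite ler_pXn2r ?nnegrE ?(ltW q0).
have e : ln n%:R = 2 * ln q :> R by rewrite qq lnXn // mulr_natl.
have h1 : A * ln q <= A * q by rewrite ler_pM2l //; apply/ltW/ln_sublinear.
have h2 : (2 * A + 2) * q <= c * q * q.
  by rewrite ler_pM2r //; move: sq; rewrite /s ler_pdivrMr // [q * c]mulrC.
by rewrite e qq expr2; move: h1 h2 q1; move: (ln q) => y; clear; lra.
Unshelve. all: by end_near.
Qed.

(** The probability is squeezed between [1 - 2^-1 ^+ n] and [1]. *)
Lemma whp_joined (R : realType) (p : nat -> R) (Z : nat) (Q : nat -> sgraph -> Prop) :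
  (0 < Z)%N -> (\forall n \near \oo, (28 * Z ^ 2)%:R / n%:R <= p n <= 1) ->
  (\forall n \near \oo, forall E : {set {set 'I_n}},
      joined_pairs (n %/ Z) E -> Q n (graph_of_edges E)) ->
  whp p Q.
Proof.
move=> Z0 hp hQ.
apply: (@squeeze_cvgr _ _ _ _ (fun n => 1 - 2^-1 ^+ n) (cst 1)); last exact: cvg_cst.
  near=> n.
  have n0 : (0 < n)%N by near: n; exact: near_ge.
  have nZ : (Z <= n)%N by near: n; exact: near_ge.
  have /andP[h1 h2] : (28 * Z ^ 2)%:R / n%:R <= p n <= 1 by near: n.
  have hE : forall E : {set {set 'I_n}}, joined_pairs (n %/ Z) E -> Q n (graph_of_edges E).
    by near: n.
  have p0 : 0 <= p n by apply: le_trans h1; apply: divr_ge0.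
  rewrite gnp_prob_le1 // andbT; apply: le_trans (gnp_prob_joined p0 h2 hE).
  rewrite lerD2l lerN2; apply: failure_bound h1 h2 => //.
  exact: div_cover.
rewrite -[X in _ --> X]subr0; apply: cvgB; first exact: cvg_cst.
apply: cvg_expr; rewrite ger0_norm ?invr_ge0 // invf_lt1 // ltr1n //.
Unshelve. all: by end_near.
Qed.

Theorem theorem7p5 (R : realType) :
  exists A : R, 0 < A /\
    forall beta : R, 0 < beta ->
      exists C : R, 0 < C /\
        forall p : nat -> R,
          (\forall n \near \oo, C / n%:R <= p n <= 1) ->
          whp p (fun n G => arrows_family G 2 (odd_cycles A beta n)) /\
          (beta < 1 / 2 ->
           whp p (fun n G =>
             arrows G 2 (cycle_graph (floor_odd ((1 / 2 - beta) * n%:R))))).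
Proof.
have ln2 : 0 < ln (2 : R) by apply: ln_gt0; rewrite ltr1n.
have A0 : 0 < 3 / ln 2 :> R by apply: divr_gt0.
exists (3 / ln 2); split => // beta b0.
(* Large enough for both [16 <= beta * r0] and [100 <= r0]. *)
pose r0 := (Num.truncn (16 / beta) + 101)%N.
have r100 : (100 <= r0)%N by rewrite /r0 addnS -addSn; apply: leq_addl.
have hb : 16 <= beta * r0%:R.
  rewrite mulrC -ler_pdivrMr //; apply: le_trans (ltW (truncnS_gt _)) _.
  by rewrite ler_nat /r0 addnS ltnS leq_addr.
pose Z := threshold r0.
have Z0 : (0 < Z)%N by apply: threshold_gt0.
exists (28 * Z ^ 2)%:R; split; first by rewrite ltr0n muln_gt0 expn_gt0 Z0.
move=> p hp; split=> [|b2].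
  apply: (whp_joined Z0 hp); near=> n => E hE c.
  have [||i hi] := joined_pairs_cycles r100 hb _ _ hE c.
  - by near: n; exact: near_ge.
  - by near: n; exact: near_ge.
  by exists i => _ [t [_ /andP[t1 t2] ->]]; apply: hi.
have c0 : 0 < 1 / 2 - beta by rewrite subr_gt0.
apply: (whp_joined Z0 hp); near=> n => E hE c.
have [||i hi] := joined_pairs_cycles r100 hb _ _ hE c.
- by near: n; exact: near_ge.
- by near: n; exact: near_ge.
(* The summand [2] pays for rounding down to an odd integer, so that this single length lies in the
   range of the family. *)
have hl : 3 / ln 2 * ln n%:R + 2 <= (1 / 2 - beta) * n%:R.
  by near: n; exact: near_log_le.
have n1 : (0 < n)%N by near: n; exact: near_ge.
have ln0 : 0 <= 3 / ln 2 * ln n%:R :> R by rewrite mulr_ge0 ?(ltW A0) // ln_ge0 // ler1n.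
have [|_ h1 h2] := @floor_odd_spec R ((1 / 2 - beta) * n%:R).
  by apply: le_trans hl; move: (3 / ln 2 * _) ln0 => x; lra.
by exists i; apply: hi => //; apply: le_trans h2; rewrite lerBrDr.
Unshelve. all: by end_near.
Qed.
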